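(* Let $(P_t)_{t\ge0}$ be a Markov semigroup with invariant probability measure $\mu$, acting on $L^2(\mu)$, with generator $(L,\mathrm{Dom}(L))$. Let $T,\nu\in(0,\infty)$ and assume that $(P_t)_{t\ge0}$ is $T$-delayed exponentially contractive with rate $\nu$, or that $(P_t)_{t\ge0}$ is exponentially contractive in $2T$-average with rate $\nu$. Then $$\frac1\nu\ge \mathrm{gap}(L)^{-1}\qquad\text{and}\qquad \frac1\nu+T\ge \mathrm{s}(L)^{-1}.$$ In particular, $t_{\mathrm{rel}}\ge\frac12\,\mathrm{s}(L)^{-1}$.
   Context: A Markov semigroup with invariant probability measure $\mu$ acts on $L^2(\mu)$ as a strongly continuous contraction semigroup. $L^2_0(\mu)=\{f\in L^2(\mu):\int f\,d\mu=0\}$. For $S,\nu\in(0,\infty)$, $(P_t)_{t\ge0}$ is called - $S$-delayed exponentially contractive with rate $\nu$ if $\|P_tf\|_{L^2(\mu)}\le e^{-\nu(t-S)}\|f\|_{L^2(\mu)}$ for all $f\in L^2_0(\mu)$ and $t\ge0$; - exponentially contractive in $S$-average with rate $\nu$ if $\frac1S\int_t^{t+S}\|P_sf\|_{L^2(\mu)}\,ds\le e^{-\nu t}\|f\|_{L^2(\mu)}$ for all $f\in L^2_0(\mu)$ and $t\ge0$. The spectral gap is $\mathrm{gap}(L)=\inf\{\mathrm{Re}(\alpha):\alpha\in\mathrm{spec}(-L|_{L^2_0(\mu)})\}$, where the spectrum is taken in the complexified Hilbert space. The singular value gap is $$\mathrm{s}(L)=\inf\Big\{\frac{\|Lf\|_{L^2(\mu)}}{\|f\|_{L^2(\mu)}}: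 f\in L^2_0(\mu)\cap\mathrm{Dom}(L),\ f\ne0\Big\}.$$ The relaxation time is $t_{\mathrm{rel}}=\inf\{t\ge0:\|P_tf\|_{L^2(\mu)}\le e^{-1}\|f\|_{L^2(\mu)}\text{ for all }f\in L^2_0(\mu)\}$. Conventions: $\inf\emptyset=+\infty$, $1/\infty=0$, $1/0=+\infty$. *)

(* Defs.v *)
From HB Require Import structures.
From mathcomp Require Import all_boot all_order all_algebra.
From mathcomp Require Import complex.
From mathcomp Require Import all_classical all_reals all_analysis.
From mathcomp Require Import measurable_realfun.

Set Implicit Arguments.
Unset Strict Implicit.
Unset Printing Implicit Defensive.

Import Order.TTheory GRing.Theory Num.Theory.
Import numFieldNormedType.Exports.

Local Open Scope classical_set_scope.
Local Open Scope quotient_scope.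
Local Open Scope complex_scope.
Local Open Scope ring_scope.

(* The library's [LfunType mu p] consists of functions and [LspaceType mu p]
   carries no algebraic structure, so L^2(mu) is rebuilt here as the normed
   module of square-integrable functions modulo equality mu-a.e. *)
Section L2_space.
Context d (T : measurableType d) (R : realType).
Variable mu : {measure set T -> \bar R}.

Local Notation L2fun := (LfunType mu (lee1n 2)).

Implicit Types f g : L2fun.

Definition L2eq f g : bool := `[< ae_eq mu setT f g >].

Let L2eq_refl : reflexive L2eq.
Proof. by move=> f; apply/asboolP; exact: ae_eq_refl. Qed.

Let L2eq_sym : symmetric L2eq.
Proof.
by move=> f g; apply/idP/idP => /asboolP h; apply/asboolP; exact: ae_eq_sym.
Qed.

Let L2eq_trans : transitive L2eq.
Proof.
by move=> g f h /asboolP fg /asboolP gh; apply/asboolP; exact: ae_eq_trans gh.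
Qed.

Canonical L2eq_equiv := EquivRel L2eq L2eq_refl L2eq_sym L2eq_trans.

Definition L2 : Type := {eq_quot L2eq}.
HB.instance Definition _ := Choice.on L2.
HB.instance Definition _ := EqQuotient.on L2.

Definition L2_of (f : L2fun) : L2 := \pi_L2 f.
Definition L2_repr (u : L2) : L2fun := repr u.
Definition L2_to_fun (u : L2) : T -> R := L2_repr u.
Coercion L2_to_fun : L2 >-> Funclass.

Lemma L2_reprK : cancel L2_repr L2_of.
Proof. exact: reprK. Qed.

Lemma L2_ofP f g : ae_eq mu setT f g <-> L2_of f = L2_of g.
Proof.
by split=> [fg|/eqP]; [apply/eqP|]; rewrite eqmodE; [apply/asboolP|move/asboolP].
Qed.

Lemma L2_repr_of f : ae_eq mu setT (L2_repr (L2_of f)) f.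
Proof. by apply/L2_ofP; rewrite L2_reprK. Qed.

Lemma L2W (P : L2 -> Prop) : (forall f, P (L2_of f)) -> forall u, P u.
Proof. by move=> Pf u; rewrite -(L2_reprK u). Qed.

Definition L2_opp (u : L2) : L2 := L2_of (- L2_repr u).
Definition L2_add (u v : L2) : L2 := L2_of (L2_repr u + L2_repr v).
Definition L2_scale (a : R) (u : L2) : L2 := L2_of (a *: L2_repr u).

Lemma L2_oppE f : L2_opp (L2_of f) = L2_of (- f).
Proof.
apply/L2_ofP; have := L2_repr_of f; apply: filterS => x /[apply] h.
by congr (- _).
Qed.

Lemma L2_addE f g : L2_add (L2_of f) (L2_of g) = L2_of (f + g).
Proof.
apply/L2_ofP; have := L2_repr_of g; have := L2_repr_of f.
by apply: filterS2 => x /(_ Logic.I) hf /(_ Logic.I) hg _; congr (_ + _).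
Qed.

Lemma L2_scaleE a f : L2_scale a (L2_of f) = L2_of (a *: f).
Proof.
apply/L2_ofP; have := L2_repr_of f; apply: filterS => x /[apply] h.
by congr (_ *: _).
Qed.

Let addA : associative L2_add.
Proof.
by elim/L2W => f; elim/L2W => g; elim/L2W => h; rewrite !L2_addE addrA.
Qed.

Let addC : commutative L2_add.
Proof. by elim/L2W => f; elim/L2W => g; rewrite !L2_addE addrC. Qed.

Let add0 : left_id (L2_of 0) L2_add.
Proof. by elim/L2W => f; rewrite L2_addE add0r. Qed.

Let addN : left_inverse (L2_of 0) L2_opp L2_add.
Proof. by elim/L2W => f; rewrite L2_oppE L2_addE addNr. Qed.

HB.instance Definition _ := GRing.isZmodule.Build L2 addA addC add0 addN.

Let scaleA a b u : L2_scale a (L2_scale b u) = L2_scale (a * b) u.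
Proof. by elim/L2W: u => f; rewrite !L2_scaleE scalerA. Qed.

Let scale1 : left_id 1 L2_scale.
Proof. by elim/L2W => f; rewrite L2_scaleE scale1r. Qed.

Let scaleDr : right_distributive L2_scale +%R.
Proof.
move=> a; elim/L2W => f; elim/L2W => g.
by rewrite [L2_of f + _]L2_addE !L2_scaleE [RHS]L2_addE scalerDr.
Qed.

Let scaleDl u : {morph L2_scale^~ u : a b / a + b}.
Proof.
by move=> a b; elim/L2W: u => f; rewrite !L2_scaleE [RHS]L2_addE scalerDl.
Qed.

HB.instance Definition _ := GRing.Zmodule_isLmodule.Build R L2
  scaleA scale1 scaleDr scaleDl.

Lemma L2_ofD f g : L2_of (f + g) = L2_of f + L2_of g.
Proof. by rewrite [RHS]L2_addE. Qed.

Lemma L2_ofZ a f : L2_of (a *: f) = a *: L2_of f.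
Proof. by rewrite [RHS]L2_scaleE. Qed.

Definition L2_norm (u : L2) : R := fine 'N[mu]_(2%:E)[EFin \o u]%E.

Lemma L2_normE f : L2_norm (L2_of f) = fine 'N[mu]_(2%:E)[EFin \o f]%E.
Proof.
rewrite /L2_norm unlock; congr (fine (_ `^ _)%E).
have mpow2 : measurable_fun [set: \bar R] (fun y => `|y| `^ 2)%E.
  exact: (measurableT_comp (measurable_poweR _)).
apply: ge0_ae_eq_integral => //.
- apply: (measurableT_comp mpow2).
  exact/measurable_EFinP/measurable_funPT.
- apply: (measurableT_comp mpow2).
  exact/measurable_EFinP/measurable_funPT.
- by move=> x _; exact: poweR_ge0.
- by move=> x _; exact: poweR_ge0.
- have := L2_repr_of f; apply: filterS => x /[apply] h.
  by congr (`|_%:E| `^ _)%E.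
Qed.

Let normD u v : L2_norm (u + v) <= L2_norm u + L2_norm v.
Proof.
elim/L2W: u => f; elim/L2W: v => g.
by rewrite -L2_ofD !L2_normE; exact: ler_LnormD.
Qed.

Let normZ a u : L2_norm (a *: u) = `|a| * L2_norm u.
Proof.
elim/L2W: u => f; rewrite -L2_ofZ !L2_normE.
by apply: EFin_inj; rewrite EFinM !finite_norm_fine LnormZ.
Qed.

Let norm0_eq0 u : L2_norm u = 0 -> u = 0.
Proof.
by elim/L2W: u => f; rewrite L2_normE => /fine_Lnormr_eq0 f0; apply/L2_ofP.
Qed.

HB.instance Definition _ := Lmodule_isNormed.Build R L2 normD normZ norm0_eq0.

Lemma L2_normr (u : L2) : `|u| = fine 'N[mu]_(2%:E)[EFin \o u]%E.
Proof. by []. Qed.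

End L2_space.

Section complexification.
Context (R : realType) (V : lmodType R).

Definition complexification : Type := (V * V)%type.

HB.instance Definition _ := GRing.Zmodule.copy complexification (V * V)%type.

(* The pair (u, v) stands for u + i v. *)
Definition complexification_scale (a : R[i]) (w : complexification) :
    complexification :=
  (complex.Re a *: w.1 - complex.Im a *: w.2,
   complex.Re a *: w.2 + complex.Im a *: w.1).

Local Notation cscale := complexification_scale.

Let cscaleA a b w : cscale a (cscale b w) = cscale (a * b) w.
Proof.
case: a b w => [a1 a2] [b1 b2] [u v]; rewrite /cscale/=.
rewrite !scalerBr !scalerDr !scalerA !scalerBl !scalerDl.
by rewrite !opprD; congr pair; rewrite -!addrA; congr (_ + _);
  rewrite addrA addrC.
Qed.

Let cscale1 : left_id 1 cscale.
Proof.
by case=> u v; rewrite /cscale/= !scale1r !scale0r subr0 addr0.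
Qed.

Let cscaleDr : right_distributive cscale +%R.
Proof.
move=> [a1 a2] [u1 v1] [u2 v2]; rewrite /cscale/=.
by rewrite !scalerDr opprD; congr pair; rewrite addrACA.
Qed.

Let cscaleDl w : {morph cscale^~ w : a b / a + b}.
Proof.
case: w => [u v] [a1 a2] [b1 b2]; rewrite /cscale/=.
by rewrite !scalerDl opprD; congr pair; rewrite addrACA.
Qed.

HB.instance Definition _ := GRing.Zmodule_isLmodule.Build R[i] complexification
  cscaleA cscale1 cscaleDr cscaleDl.

Definition complexify_set (H : set V) : set complexification :=
  [set w | H w.1 /\ H w.2].

Definition complexify_op (A : V -> V) (w : complexification) : complexification :=
  (A w.1, A w.2).

End complexification.

Section spectrum.
Context (R : realType) (V : normedModType R).

Definition complexification_norm (w : complexification V) : R :=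
  Num.sqrt (`|w.1| ^+ 2 + `|w.2| ^+ 2).

(* [A] is an unbounded operator with domain [D] on the subspace [H] of [V];
   its values outside [D] play no role. *)
Definition resolvent_set (H D : set V) (A : V -> V) : set R[i] :=
  [set a | let S w := a *: w - complexify_op A w in
    set_bij (complexify_set D) (complexify_set H) S /\
    exists M : R, forall w, complexify_set D w ->
      complexification_norm w <= M * complexification_norm (S w)].

Definition spectrum (H D : set V) (A : V -> V) : set R[i] :=
  ~` resolvent_set H D A.

End spectrum.

Section semigroup.
Context (R : realType) (V : normedModType R).

(* Only the times [0 <= t] of the family [P] are meaningful. *)
Record c0_contraction_semigroup (P : R -> {linear V -> V}) : Prop := {
  semigroup0 : forall f, P 0 f = f;
  semigroupD : forall s t f, 0 <= s -> 0 <= t -> P (s + t) f = P s (P t f);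
  semigroup_contraction : forall t f, 0 <= t -> `|P t f| <= `|f|;
  semigroup_continuous : forall f, P t f @[t --> 0^'+] --> f }.

Definition difference_quotient (P : R -> {linear V -> V}) (f : V) (h : R) : V :=
  h^-1 *: (P h f - f).

Definition generator_dom (P : R -> {linear V -> V}) : set V :=
  [set f | cvg (difference_quotient P f h @[h --> 0^'+])].

Definition generator (P : R -> {linear V -> V}) (f : V) : V :=
  lim (difference_quotient P f h @[h --> 0^'+]).

End semigroup.

Section markov.
Context d (X : measurableType d) (R : realType) (mu : probability X R).

Record markov_semigroup (P : R -> {linear L2 mu -> L2 mu}) : Prop := {
  markov_c0 : c0_contraction_semigroup P;
  markov_ge0 : forall t (f : L2 mu), 0 <= t ->
    {ae mu, forall x, 0 <= f x} -> {ae mu, forall x, 0 <= (P t f : L2 mu) x};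
  markov_1 : forall t (f : L2 mu), 0 <= t ->
    {ae mu, forall x, f x = 1} -> {ae mu, forall x, (P t f : L2 mu) x = 1};
  markov_invariant : forall t (f : L2 mu), 0 <= t ->
    (\int[mu]_x ((P t f : L2 mu) x)%:E = \int[mu]_x (f x)%:E)%E }.

Definition L20 : set (L2 mu) := [set f | (\int[mu]_x (f x)%:E = 0)%E].

Implicit Type P : R -> {linear L2 mu -> L2 mu}.

Definition delayed_exp_contractive P (S nu : R) : Prop :=
  forall (f : L2 mu) (t : R), L20 f -> 0 <= t ->
    `|P t f| <= expR (- nu * (t - S)) * `|f|.

Definition average_exp_contractive P (S nu : R) : Prop :=
  forall (f : L2 mu) (t : R), L20 f -> 0 <= t ->
    (S^-1%:E * \int[lebesgue_measure]_(s in `[t, (t + S)%R]) (`|P s f|%R)%:E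
      <= (expR (- nu * t) * `|f|)%:E)%E.

Definition spectral_gap P : \bar R :=
  ereal_inf [set (complex.Re a)%:E | a in
    spectrum L20 (L20 `&` generator_dom P) (fun f => - generator P f)].

Definition singular_value_gap P : \bar R :=
  ereal_inf [set (`|generator P f| / `|f|)%:E | f in
    L20 `&` generator_dom P `&` [set f | f != 0]].

Definition relaxation_time P : \bar R :=
  ereal_inf [set t%:E | t in
    [set t | 0 <= t /\ forall f, L20 f -> `|P t f| <= expR (-1) * `|f|]].

End markov.

(* Main.v *)
From HB Require Import structures.
Require Import Defs.
From mathcomp Require Import all_boot all_order all_algebra.
From mathcomp Require Import complex.
From mathcomp Require Import all_classical all_reals all_analysis.
From mathcomp Require Import measurable_realfun.
From mathcomp Require Import ring lra.
Import Order.TTheory GRing.Theory Num.Theory.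
Import numFieldNormedType.Exports.

(* Let [N f] be [|P_T f|] in the delayed case and the mean of [|P_s f|] over
   [s] in [[0, 2T]] in the averaged case, so that [N (P_t f) <= e^(-nu t) |f|].
   Subadditivity of [N] and the telescoping sum
     [f = \sum_(j < n) P_(jh) (f - P_h f) + P_(nh) f]
   give [N f <= |L f| / nu] as [n -> oo] and then [h -> 0], while
   [|f - P_s f| <= s |L f|] gives [|f| <= N f + T |L f|]; hence the bound on the
   singular value gap.
   For the spectral gap, averaged contractivity implies delayed contractivity by
   monotonicity of [|P_s f|].  If [Re a < nu], the semigroup [Q_t = e^(at) P_t]
   decays exponentially on the complexification, so the telescoping argument
   bounds its generator [a + L] from below, and [- \int_0^oo Q_t f dt], the limit
   of Riemann sums in the complete space [L^2_0], solves [(a + L) u = f].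
   Finally [|P_t f| <= e^-1 |f|] makes [P] [t]-delayed contractive with rate
   [1/t]. *)

Set Implicit Arguments.
Unset Strict Implicit.
Unset Printing Implicit Defensive.
Local Open Scope classical_set_scope.
Local Open Scope ring_scope.

(** * Decaying semigroups *)

Lemma at_right0P (R : realType) (A : set R) :
  (\forall h \near 0^'+, A h) <->
  exists2 d : R, 0 < d & forall h, 0 < h < d -> A h.
Proof.
split=> [|[d d0 dA]].
  rewrite /at_right near_withinE => /nbhs_ballP[d /= d0 dA].
  exists d => // h /andP[h0 hd].
  by apply: dA => //=; rewrite -ball_normE /= sub0r normrN gtr0_norm.
by near=> h; apply: dA; apply/andP; split.
Unshelve. all: by end_near. Qed.

Lemma cvg_at_right0P (R : realType) (V : normedModType R) (F : R -> V) (l : V) :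
  F h @[h --> 0^'+] --> l <->
  forall e, 0 < e -> exists2 d : R, 0 < d & forall h, 0 < h < d -> `|F h - l| <= e.
Proof.
split=> [/cvgrPdist_le Fl e e0|Fl].
  by have /at_right0P[d d0 dF] := Fl e e0; exists d => // h /dF; rewrite distrC.
apply/cvgrPdist_le => e /Fl[d d0 dF].
by apply/at_right0P; exists d => // h /dF; rewrite distrC.
Qed.

(** With [q = e^(-nu s)], the inequality [e^x >= 1 + x] gives [s <= (1/nu + s) (1 - q)], and the sum
    is geometric in [q]. A left Riemann sum of [e^(-nu t)] thus overshoots its integral [1/nu] by at
    most one mesh. *)
Lemma geometric_decay_le (R : realType) (nu s : R) (n : nat) : 0 < nu -> 0 <= s ->
  s * (\sum_(j < n) expR (- nu * (s * j%:R))) <= nu^-1 + s.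
Proof.
move=> nu0 s0; set q := expR (- (nu * s)).
have qE j : expR (- nu * (s * j%:R)) = q ^+ j by rewrite mulrA expRM_natr mulNr.
have q0 : 0 <= q by exact: expR_ge0.
have sq : s <= (nu^-1 + s) * (1 - q).
  have e1 : nu * nu^-1 = 1 by rewrite divff ?gt_eqF.
  rewrite -(ler_pM2l nu0) mulrA [nu * (_ + _)]mulrDr e1.
  suff : q * (1 + nu * s) <= 1 by nra.
  have := ler_wpM2l q0 (expR_ge1Dx (nu * s)).
  by rewrite [q * expR _]mulrC expRxMexpNx_1.
have nus0 : 0 <= nu^-1 + s by rewrite addr_ge0// invr_ge0 ltW.
suff : s * (\sum_(j < n) expR (- nu * (s * j%:R))) <= (nu^-1 + s) * (1 - q ^+ n).
  move=> /le_trans; apply; rewrite ler_piMr// gerBl exprn_ge0//.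
elim: n => [|n IHn]; first by rewrite big_ord0 expr0 subrr !mulr0.
rewrite big_ord_recr /= mulrDr qE exprS.
have := ler_wpM2r (exprn_ge0 n q0) sq; lra.
Qed.

Lemma expRN_natr_small (R : realType) (nu s c e : R) : 0 < nu -> 0 < s -> 0 < e ->
  exists n0, forall n, (n0 <= n)%N -> c * expR (- nu * (s * n%:R)) <= e.
Proof.
move=> nu0 s0 e0; exists (Num.truncn (`|c| / (nu * s * e))).+1 => n hn.
apply: (@le_trans _ _ (`|c| * expR (- nu * (s * n%:R)))).
  by rewrite ler_wpM2r ?expR_ge0// ler_norm.
rewrite mulNr expRN ler_pdivrMr ?expR_gt0//.
apply: (@le_trans _ _ (e * (nu * (s * n%:R)))).
  have -> : e * (nu * (s * n%:R)) = n%:R * (nu * s * e) by ring.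
  rewrite -ler_pdivrMr ?mulr_gt0//; apply: le_trans (ltW (truncnS_gt _)) _.
  by rewrite ler_nat.
by rewrite ler_pM2l//; apply: le_trans (expR_ge1Dx _); rewrite lerDr.
Qed.

(** * Telescoping bound for a subadditive functional decaying along a semigroup *)

Section decay.
Context (R : realType) (V : normedModType R).
Variables (Q : R -> {linear V -> V}) (H : set V) (N : V -> R) (C nu : R).
Hypothesis QD : forall s t f, 0 <= s -> 0 <= t -> Q (s + t) f = Q s (Q t f).
Hypothesis HB : forall f g, H f -> H g -> H (f - g).
Hypothesis HQ : forall t f, 0 <= t -> H f -> H (Q t f).
Hypothesis ND : forall f g, N (f + g) <= N f + N g.
Hypothesis nu0 : 0 < nu.
Hypothesis C0 : 0 <= C.
Hypothesis Q0 : forall f, Q 0 f = f.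
Hypothesis NQ : forall t f, 0 <= t -> H f ->
  N (Q t f) <= C * expR (- nu * t) * `|f|.

Lemma telescope_le f s n : 0 <= s ->
  N f <= (\sum_(j < n) N (Q (s * j%:R) (f - Q s f))) + N (Q (s * n%:R) f).
Proof.
move=> s0; elim: n => [|n /le_trans]; first by rewrite big_ord0 mulr0 Q0 add0r.
apply; rewrite big_ord_recr /= -addrA lerD2l -natr1 mulrDr mulr1 QD ?mulr_ge0//.
by rewrite (le_trans _ (ND _ _))// linearB /= subrK.
Qed.

(** The telescoping terms add up to a geometric series, and the remainder [N (Q (s n) f)] vanishes
    as [n] grows. The step [s] stays positive here: the generator bound lets it tend to 0, while the
    Cauchy estimate for Riemann sums uses a fixed one. *)
Lemma decay_le f s : 0 < s -> H f ->
  s * N f <= C * (nu^-1 + s) * `|f - Q s f|.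
Proof.
move=> s0 Hf; apply/ler_addgt0Pr => e e0.
have [n /(_ n (leqnn n)) hn] := expRN_natr_small (s * C * `|f|) nu0 s0 e0.
have s0' := ltW s0.
have := ler_wpM2l s0' (telescope_le f n s0') => /le_trans; apply.
rewrite mulrDr lerD//; last first.
  apply: le_trans hn; rewrite -!mulrA ler_pM2l//.
  by apply: le_trans (NQ _ Hf) _; rewrite ?mulr_ge0// mulrAC -mulrA.
have Hd : H (f - Q s f) by apply: HB => //; exact: HQ.
apply: (@le_trans _ _ (s * \sum_(j < n) (C * expR (- nu * (s * j%:R)) * `|f - Q s f|))).
  by rewrite ler_pM2l// ler_sum// => j _; apply: NQ => //; rewrite mulr_ge0.
rewrite -mulr_suml -mulr_sumr mulrA ler_wpM2r// mulrCA ler_wpM2l//.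
exact: geometric_decay_le.
Qed.

Lemma decay_generator_le f g : H f ->
  difference_quotient Q f h @[h --> 0^'+] --> g -> N f <= C / nu * `|g|.
Proof.
move=> Hf /cvg_norm fg.
have cg : C * (nu^-1 + s) * `|difference_quotient Q f s| @[s --> 0^'+] -->
    C * (nu^-1 + 0) * `|g|.
  apply: cvgM => //; apply: cvgM; first exact: cvg_cst.
  apply: cvgD; first exact: cvg_cst.
  by apply: cvg_at_right_filter; exact: cvg_id.
rewrite addr0 in cg; apply: (cvgr_to_ge cg).
apply/at_right0P; exists 1 => // s /andP[s0 _].
rewrite -(ler_pM2l s0); apply: le_trans (decay_le s0 Hf) _.
rewrite /difference_quotient normrZ gtr0_norm ?invr_gt0// distrC.
by rewrite mulrCA [s * _]mulrA divff ?gt_eqF// mul1r.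
Qed.

End decay.

(** Completeness is asked of a subset, so that it can be used for [L20] and for pairs of its
    elements. *)
Definition seq_complete (R : realType) (V : normedModType R) (H : set V) : Prop :=
  forall u : nat -> V, (forall n, H (u n)) ->
    (forall e : R, 0 < e -> exists n0, forall m n, (n0 <= m)%N -> (n0 <= n)%N ->
      `|u m - u n| <= e) ->
    exists2 l, H l &
      forall e : R, 0 < e -> exists n0, forall n, (n0 <= n)%N -> `|u n - l| <= e.

(** * Inverting the generator of a decaying semigroup by Riemann sums *)

Section resolvent.
Context (R : realType) (V : normedModType R).
Variables (Q : R -> {linear V -> V}) (H : set V) (K nu : R).
Hypothesis Q0 : forall f, Q 0 f = f.
Hypothesis QD : forall s t f, 0 <= s -> 0 <= t -> Q (s + t) f = Q s (Q t f).
Hypothesis Qc : forall f, H f -> Q t f @[t --> 0^'+] --> f.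
Hypothesis H_0 : H 0.
Hypothesis HZD : forall a f g, H f -> H g -> H (a *: f + g).
Hypothesis HQ : forall t f, 0 <= t -> H f -> H (Q t f).
Hypothesis H_complete : seq_complete H.
Hypothesis K0 : 0 <= K.
Hypothesis nu0 : 0 < nu.
Hypothesis Qnu : forall t f, 0 <= t -> H f -> `|Q t f| <= K * expR (- nu * t) * `|f|.

Let HB f g : H f -> H g -> H (f - g).
Proof. by move=> Hf Hg; rewrite addrC -scaleN1r; exact: HZD. Qed.

Let HD f g : H f -> H g -> H (f + g).
Proof. by move=> Hf Hg; rewrite -[f]scale1r; exact: HZD. Qed.

Let HZ a f : H f -> H (a *: f).
Proof. by move=> Hf; rewrite -[_ *: _]addr0; exact: HZD. Qed.

Let QK t f : 0 <= t -> H f -> `|Q t f| <= K * `|f|.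
Proof.
move=> t0 Hf; apply: le_trans (Qnu t0 Hf) _; rewrite ler_wpM2r// ler_piMr//.
by rewrite -expR0 ler_expR mulNr oppr_le0 mulr_ge0// ltW.
Qed.

(** Left Riemann sum of mesh [h] for the integral of [Q t f] over [[0, h m]]. *)
Definition riemann_sum (h : R) (m : nat) (f : V) : V :=
  h *: \sum_(j < m) Q (h * j%:R) f.

Local Notation A := riemann_sum.

Lemma riemann_sum_in h m f : 0 <= h -> H f -> H (A h m f).
Proof.
move=> h0 Hf; apply: HZ; elim/big_ind : _ => // j _.
by apply: HQ => //; rewrite mulr_ge0.
Qed.

Lemma riemann_sumD h m k f : 0 <= h ->
  A h (m + k) f = A h m f + Q (h * m%:R) (A h k f).
Proof.
move=> h0; rewrite /A big_split_ord /= scalerDr linearZ /=.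
rewrite [Q _ (\sum_(_ < _) _)]linear_sum.
by congr (_ + _ *: _); apply: eq_bigr => j _; rewrite natrD mulrDr QD ?mulr_ge0.
Qed.

(** Splitting the sum of [m + k] terms after [m] or after [k] terms gives the same value. For large
    [m] the last term is negligible, so the increment of the long sum under [Q (h k)] is nearly the
    short sum over [[0, h k]]. *)
Lemma riemann_sum_sub_semigroup h m k f : 0 <= h ->
  A h m f - Q (h * k%:R) (A h m f) = A h k f - Q (h * m%:R) (A h k f).
Proof.
move=> h0; apply/eqP; rewrite subr_eq addrAC -subr_eq opprK.
by rewrite -!riemann_sumD// addnC.
Qed.

Lemma semigroup_riemann_sum h m r f : 0 <= h -> 0 <= r ->
  Q r (A h m f) = A h m (Q r f).
Proof.
move=> h0 r0; rewrite /A linearZ /= [Q _ (\sum_(_ < _) _)]linear_sum; congr (_ *: _).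
by apply: eq_bigr => j _; rewrite -!QD ?mulr_ge0// addrC.
Qed.

Lemma riemann_sum_near h k f e : 0 <= h ->
  (forall r, 0 <= r <= h * k%:R -> `|Q r f - f| <= e) ->
  `|A h k f - (h * k%:R) *: f| <= h * k%:R * e.
Proof.
move=> h0 fe; have -> : (h * k%:R) *: f = h *: \sum_(j < k) f.
  by rewrite -scalerA sumr_const card_ord scaler_nat.
rewrite -scalerBr normrZ ger0_norm// -mulrA ler_wpM2l// -sumrB.
apply: le_trans (ler_norm_sum _ _ _) _.
rewrite mulr_natl -[in leRHS](card_ord k) -sumr_const; apply: ler_sum => j _.
by apply: fe; rewrite mulr_ge0//= ler_wpM2l// ler_nat ltnW.
Qed.

Lemma norm_riemann_sum h m f : 0 <= h -> H f ->
  `|A h m f| <= K * (nu^-1 + h) * `|f|.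
Proof.
move=> h0 Hf; rewrite /A normrZ ger0_norm//.
apply: (@le_trans _ _ (h * \sum_(j < m) (K * expR (- nu * (h * j%:R)) * `|f|))).
  rewrite ler_wpM2l//; apply: le_trans (ler_norm_sum _ _ _) _.
  by apply: ler_sum => j _; apply: Qnu => //; rewrite mulr_ge0.
rewrite -mulr_suml -mulr_sumr mulrA ler_wpM2r// mulrCA ler_wpM2l//.
exact: geometric_decay_le.
Qed.

(* The Riemann sum of mesh [1 / (n + 1)] for the integral over [[0, n + 1]]. *)
Let u (f : V) (n : nat) : V := A n.+1%:R^-1 (n.+1 ^ 2)%N f.

Let hE n : n.+1%:R^-1 * (n.+1 ^ 2)%N%:R = n.+1%:R :> R.
Proof. by rewrite natrX expr2 mulKf. Qed.

Let u_in f n : H f -> H (u f n).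
Proof. by move=> Hf; exact: riemann_sum_in. Qed.

(** Bounds the Riemann sums of all meshes at most 1, whatever their number of terms. *)
Let K' := K * (nu^-1 + 1).

Let K'0 : 0 <= K'.
Proof. by rewrite mulr_ge0// addr_ge0// invr_ge0 ltW. Qed.

Let near0 f e : H f -> 0 < e ->
  exists2 d : R, 0 < d & forall r, 0 <= r < d -> `|Q r f - f| <= e.
Proof.
move=> Hf e0; have /cvg_at_right0P/(_ e e0)[d d0 de] := Qc Hf.
exists d => // r /andP[]; rewrite le_eqVlt => /predU1P[<- _|r0 rd].
  by rewrite Q0 subrr normr0 ltW.
by apply: de; rewrite r0.
Qed.

(* [s] need not be a multiple of the mesh [h]: the remainder [r = s - h k < h]
   contributes [u - Q r u], the Riemann sum of [f - Q r f], which is small. *)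
Let approx f e d : H f ->
  (forall r, 0 <= r < d -> `|Q r f - f| <= e) ->
  forall s e', 0 < s < d -> 0 < e' -> exists n0, forall n, (n0 <= n)%N ->
    `|(u f n - Q s (u f n)) - s *: f| <= s * e + e'.
Proof.
move=> Hf de s e' /andP[s0 sd] e'0.
have e0 : 0 <= e by apply: le_trans (normr_ge0 _) (de 0 _); rewrite lexx (lt_trans s0 sd).
have e30 : 0 < e' / 3 by rewrite divr_gt0.
(* Makes the tail of the integral beyond time [n + 1] small. *)
have [n1 hn1] := expRN_natr_small (K * (K' * `|f|)) nu0 ltr01 e30.
(* Chosen so that [K K' e2 <= e' / 3]; the added 1 keeps the denominator positive. *)
pose e2 := e' / 3 / (K * K' + 1).
have KK0 : 0 < K * K' + 1 by rewrite ltr_wpDl// mulr_ge0.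
have e20 : 0 < e2 by rewrite divr_gt0.
have [d2 d20 de2] := near0 Hf e20.
(* The three summands ensure [h < d2], [h |f| <= e' / 3] and [n1 <= n + 1]. *)
pose M := (Num.truncn (d2^-1) + Num.truncn (`|f| / (e' / 3)) + n1)%N.
exists M => n Mn.
set h : R := n.+1%:R^-1.
have h0 : 0 < h by rewrite invr_gt0.
have h0' := ltW h0.
have h1 : h <= 1 by rewrite invf_le1// ler1n.
have hd2 : h < d2.
  rewrite /h invf_plt ?posrE//; apply: lt_le_trans (truncnS_gt _) _.
  by rewrite ler_nat ltnS (leq_trans _ Mn)// /M -addnA leq_addr.
have hf : h * `|f| <= e' / 3.
  rewrite /h mulrC ler_pdivrMr// mulrC -ler_pdivrMr//.
  apply: le_trans (ltW (truncnS_gt _)) _.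
  by rewrite ler_nat ltnS (leq_trans _ Mn)// /M addnAC leq_addl.
have n1n : (n1 <= n.+1)%N by rewrite (leq_trans _ (leq_trans Mn _))// leq_addl.
pose k := Num.truncn (s / h).
have /truncn_itv/andP[ks sk] : 0 <= s / h by rewrite divr_ge0 ?ltW.
rewrite ler_pdivlMr// mulrC in ks; rewrite ltr_pdivrMr// -natr1 mulrDl mul1r mulrC in sk.
rewrite -/k in ks sk.
have hk0 : 0 <= h * k%:R by rewrite mulr_ge0.
pose r := s - h * k%:R.
have r0 : 0 <= r by rewrite subr_ge0.
have rh : r <= h by rewrite /r lerBlDr addrC ltW.
have sE : s = h * k%:R + r by rewrite /r; ring.
pose v := u f n.
have vE : v = A h (n.+1 ^ 2) f by [].
have Hv : H v by exact: u_in.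
(* Four errors: [Q] moves [f] slightly on [[0, h k]], the remainder [r] is dropped from [s], the
   integral has a tail beyond [n + 1], and [h k] is replaced by [s]. The first costs [s e], each of
   the others [e' / 3]. *)
have -> : v - Q s v - s *: f =
    (A h k f - (h * k%:R) *: f) - r *: f - Q n.+1%:R (A h k f)
    + Q (h * k%:R) (v - Q r v).
  have vk : v - Q (h * k%:R) v = A h k f - Q n.+1%:R (A h k f).
    by rewrite -(hE n) -riemann_sum_sub_semigroup.
  have -> : s *: f = (h * k%:R) *: f + r *: f by rewrite -scalerDl -sE.
  rewrite linearB /= -QD// -sE; set x := _ *: f; set y := r *: f.
  transitivity (v - Q (h * k%:R) v + Q (h * k%:R) v - Q s v - (x + y)).
    by rewrite subrK.
  by rewrite vk opprD !addrA [RHS](ACl (1*4*5*6*2*3)).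
have b1 : `|A h k f - (h * k%:R) *: f| <= s * e.
  apply: (@le_trans _ _ (h * k%:R * e)); last by rewrite ler_wpM2r.
  apply: riemann_sum_near => // t /andP[t0 tk]; apply: de; rewrite t0/=.
  exact: le_lt_trans (le_trans tk ks) sd.
have b2 : `|r *: f| <= e' / 3.
  by rewrite normrZ ger0_norm//; apply: le_trans hf; rewrite ler_wpM2r.
have HA : H (A h k f) by exact: riemann_sum_in.
have hK' : K * (nu^-1 + h) <= K' by rewrite /K' ler_wpM2l// lerD2l.
have b3 : `|Q n.+1%:R (A h k f)| <= e' / 3.
  apply: le_trans (hn1 _ n1n); apply: le_trans (Qnu _ HA) _ => //.
  rewrite mul1r mulrAC -mulrA -[leRHS]mulrA ler_wpM2l// mulrC [leRHS]mulrC.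
  rewrite ler_wpM2l ?expR_ge0//; apply: le_trans (norm_riemann_sum _ _ Hf) _ => //.
  by rewrite ler_wpM2r.
have b4 : `|Q (h * k%:R) (v - Q r v)| <= e' / 3.
  have Hfr : H (Q r f - f) by apply: HB => //; exact: HQ.
  apply: le_trans (QK _ _) _ => //; first by apply: HB => //; exact: HQ.
  rewrite distrC vE semigroup_riemann_sum//.
  have -> : A h (n.+1 ^ 2) (Q r f) - A h (n.+1 ^ 2) f = A h (n.+1 ^ 2) (Q r f - f).
    rewrite /A -scalerBr -sumrB; congr (_ *: _).
    by apply: eq_bigr => j _; rewrite linearB.
  apply: (@le_trans _ _ (K * (K' * e2))).
    rewrite ler_wpM2l//; apply: le_trans (norm_riemann_sum _ _ Hfr) _ => //.
    apply: ler_pM => //; first by rewrite mulr_ge0// addr_ge0// invr_ge0 ltW.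
    by apply: de2; rewrite r0 (le_lt_trans rh).
  rewrite mulrA /e2 mulrCA mulrC ler_piMl ?ltW//.
  by rewrite ltr_pdivrMr// mul1r ltrDl.
apply: le_trans (ler_normD _ _) _; apply: le_trans (lerD (ler_normB _ _) (lexx _)) _.
apply: le_trans (lerD (lerD (ler_normB _ _) (lexx _)) (lexx _)) _.
lra.
Qed.

(** By [approx], both Riemann sums have nearly the same increment [s *: f] under [Q s], and
    [decay_le] bounds their difference by the difference of these increments. *)
Let cauchy_u f : H f -> forall e, 0 < e -> exists n0, forall m n,
  (n0 <= m)%N -> (n0 <= n)%N -> `|u f m - u f n| <= e.
Proof.
move=> Hf e e0; pose e1 := e / (4 * (K' + 1)).
have K'1 : 0 < K' + 1 by rewrite ltr_wpDl.
have e10 : 0 < e1 by rewrite divr_gt0// mulr_gt0.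
have [d d0 de] := near0 Hf e10.
(* Below [d] for [approx], and at most 1 so that the constant of [decay_le] is at most [K']. *)
pose s := Num.min (d / 2) 1.
have s0 : 0 < s by rewrite lt_min ltr01 divr_gt0.
have sd : s < d by rewrite gt_min ltr_pdivrMr// ltr_pMr// ltr1n.
have s1 : s <= 1 by rewrite ge_min lexx orbT.
have [|n0 hn0] := approx Hf de (s := s) _ (mulr_gt0 s0 e10); first by rewrite s0.
exists n0 => m n /hn0 hm /hn0 hn; rewrite -(ler_pM2l s0).
apply: le_trans (decay_le QD HB HQ (@ler_normD _ _) nu0 K0 Q0 Qnu s0 _) _.
  by apply: HB; exact: u_in.
apply: (@le_trans _ _ (K' * (4 * (s * e1)))).
  apply: ler_pM => //; first by rewrite mulr_ge0// addr_ge0 ?invr_ge0 ?ltW.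
    by rewrite ler_wpM2l// lerD2l.
  have -> : u f m - u f n - Q s (u f m - u f n) =
      (u f m - Q s (u f m) - s *: f) - (u f n - Q s (u f n) - s *: f).
    by rewrite linearB /= !opprB !addrA [RHS](ACl (1*6*5*2*(3*4)))  /= ;
      rewrite addNr addr0.
  by apply: le_trans (ler_normB _ _) _; lra.
have -> : s * e = s * (e1 * (4 * (K' + 1))) by rewrite /e1 divfK// gt_eqF// mulr_gt0.
have := mulr_gt0 s0 e10; lra.
Qed.

(** The limit [v] of the Riemann sums, formally the integral of [Q t f] over all times, inherits the
    estimate [approx] with [e'] tending to 0, so [(v - Q s v) / s] tends to [f]. *)
Lemma resolvent_onto f : H f ->
  exists2 v, H v & difference_quotient Q v h @[h --> 0^'+] --> - f.
Proof.
move=> Hf; have [v Hv uv] := H_complete (fun n => u_in n Hf) (cauchy_u Hf).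
exists v => //; apply/cvg_at_right0P => e e0.
have [d d0 de] := near0 Hf e0; exists d => // s sd.
have s0 : 0 < s by case/andP : sd.
have {}s0' := ltW s0.
rewrite -(ler_pM2l s0) -{1}(gtr0_norm s0) -normrZ /difference_quotient.
rewrite opprK scalerDr scalerA divff ?gt_eqF// scale1r -normrN opprD opprB.
apply/ler_addgt0Pr => e' e'0.
have e20 : 0 < e' / 2 by rewrite divr_gt0.
have [n1 h1] := approx Hf de sd e20.
(* Replacing [u f n] by [v] costs at most [(1 + K) |u f n - v|], to be kept below [e' / 2]. *)
have K10 : 0 < 2 * (K + 1) by rewrite mulr_gt0// ltr_wpDl.
have [n2 h2] := uv _ (divr_gt0 e'0 K10).
pose n := maxn n1 n2.
have {h1} := h1 n (leq_maxl _ _); have {h2} := h2 n (leq_maxr _ _).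
rewrite ler_pdivlMr// => h2 h1.
have -> : v - Q s v - s *: f =
    (u f n - Q s (u f n) - s *: f) - (u f n - v) + Q s (u f n - v).
  rewrite [Q s (_ - v)]linearB /= !opprB !addrA.
  by rewrite [RHS](ACl (4*7*3*(1*5)*(2*6))) /= subrr addNr !addr0.
have h3 : `|Q s (u f n - v)| <= K * `|u f n - v|.
  by apply: QK => //; apply: HB => //; exact: u_in.
apply: le_trans (ler_normD _ _) _; apply: le_trans (lerD (ler_normB _ _) (lexx _)) _.
nra.
Qed.

End resolvent.

(** * Complexification and the spectral gap *)

Section rotation.
Context (R : realType) (V : normedModType R).

(** Multiplication of [u + i v] by [c + i s], written over the reals so that the preceding results
    apply to the real normed module [V * V]. *)
Definition rotation (c s : R) (w : V * V) : V * V :=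
  (c *: w.1 - s *: w.2, c *: w.2 + s *: w.1).

Lemma rotation_linear c s : linear (rotation c s).
Proof.
move=> k [u1 u2] [v1 v2]; rewrite /rotation /=.
rewrite !scalerDr !scalerA !opprD; congr (_, _) => /=.
  by rewrite scalerBr !scalerA [c * k]mulrC [s * k]mulrC !addrA [RHS](ACl (1*3*2*4)).
by rewrite scalerDr !scalerA [c * k]mulrC [s * k]mulrC !addrA [RHS](ACl (1*3*2*4)).
Qed.

HB.instance Definition _ c s :=
  GRing.isLinear.Build R (V * V)%type (V * V)%type _ (rotation c s) (rotation_linear c s).

Lemma rotationM c s c' s' w :
  rotation c s (rotation c' s' w) = rotation (c * c' - s * s') (c * s' + s * c') w.
Proof.
case: w => u v; rewrite /rotation /=.
rewrite !scalerBr !scalerDr !scalerDl !scaleNr !scalerA.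
rewrite ?opprD; congr (_, _) => /=; rewrite !addrA.
  by rewrite [RHS](ACl (1*3*4*2)).
by rewrite [RHS](ACl (1*3*4*2)).
Qed.

Lemma rotation10 w : rotation 1 0 w = w.
Proof. by case: w => u v; rewrite /rotation /= !scale1r !scale0r subr0 addr0. Qed.

Lemma norm_rotation c s w : `|rotation c s w| <= (`|c| + `|s|) * `|w|.
Proof.
have w1 : `|w.1| <= `|w| by rewrite prod_normE le_max lexx.
have w2 : `|w.2| <= `|w| by rewrite prod_normE le_max lexx orbT.
rewrite [leLHS]prod_normE /rotation /= ge_max mulrDl; apply/andP; split.
  by apply: le_trans (ler_normB _ _) _; rewrite !normrZ lerD// ler_wpM2l.
by apply: le_trans (ler_normD _ _) _; rewrite !normrZ lerD// ler_wpM2l.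
Qed.

Lemma cvg_rotation T (F : set_system T) {FF : ProperFilter F} (c s : T -> R)
    (G : T -> V * V) (a b : R) (w : V * V) :
  c x @[x --> F] --> a -> s x @[x --> F] --> b -> G x @[x --> F] --> w ->
  rotation (c x) (s x) (G x) @[x --> F] --> rotation a b w.
Proof.
move=> ca sb Gw.
have G1 : (G x).1 @[x --> F] --> w.1 by apply: cvg_comp Gw _; exact: cvg_fst.
have G2 : (G x).2 @[x --> F] --> w.2 by apply: cvg_comp Gw _; exact: cvg_snd.
by apply: cvg_pair; [apply: cvgB|apply: cvgD]; apply: cvgZ.
Qed.

(** Product rule at 0: with [z h = c h + i s h], the quotient [(z F - w) / h] is
    [((z - 1) / h) F + (F - w) / h]. *)
Lemma rotation_difference_quotient (c s : R -> R) (a b : R) (F : R -> V * V)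
    (w z : V * V) :
  h^-1 * (c h - 1) @[h --> 0^'+] --> a -> h^-1 * s h @[h --> 0^'+] --> b ->
  F h @[h --> 0^'+] --> w -> h^-1 *: (F h - w) @[h --> 0^'+] --> z ->
  h^-1 *: (rotation (c h) (s h) (F h) - w) @[h --> 0^'+] --> rotation a b w + z.
Proof.
move=> ca sb Fw Fz.
have -> : (fun h => h^-1 *: (rotation (c h) (s h) (F h) - w)) =
    (fun h => rotation (h^-1 * (c h - 1)) (h^-1 * s h) (F h) + h^-1 *: (F h - w)).
  apply/funext => h.
  have -> : rotation (h^-1 * (c h - 1)) (h^-1 * s h) (F h) =
      h^-1 *: rotation (c h - 1) (s h) (F h).
    by rewrite /rotation; congr (_, _) => /=; rewrite ?scalerBr ?scalerDr !scalerA.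
  rewrite -scalerDr; congr (_ *: _).
  suff -> : rotation (c h - 1) (s h) (F h) = rotation (c h) (s h) (F h) - F h.
    by rewrite addrA subrK.
  rewrite /rotation !scalerBl !scale1r; case: (F h) => u v /=.
  by congr (_, _) => /=; rewrite addrAC.
by apply: cvgD => //; exact: cvg_rotation.
Qed.

End rotation.

(** * Derivative at 0 of the complex exponential *)

Section exp_twist.
Context (R : realType).
Implicit Types a b h : R.

Lemma is_derive_at_right (f : R -> R) (l : R) :
  is_derive (0 : R) (1 : R) f l -> h^-1 * (f h - f 0) @[h --> 0^'+] --> l.
Proof.
move=> [df fl].
have : h^-1 *: ((f \o shift 0) (h *: (1 : R)) - f 0) @[h --> 0^'] --> l.
  by rewrite -fl; exact: df.
move/cvg_dnbhs_at_right; apply: cvg_trans; apply: near_eq_cvg; near=> h.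
by rewrite /= addr0 [h *: 1]mulr1.
Unshelve. all: by end_near. Qed.

Let derive_mul a : is_derive (0 : R) (1 : R) ( *%R a) a.
Proof.
have := is_deriveZ a (is_derive_id (0 : R) (1 : R)).
by rewrite [a *: 1]mulr1.
Qed.

Let derive_exp a : is_derive (0 : R) (1 : R) (expR \o *%R a) a.
Proof.
have := is_derive1_comp (is_derive_expR (a * 0)) (derive_mul a).
by rewrite mulr0 expR0 mul1r.
Qed.

Lemma exp_cos_derivative a b :
  h^-1 * (expR (a * h) * cos (b * h) - 1) @[h --> 0^'+] --> a.
Proof.
have dcos : is_derive (0 : R) (1 : R) (cos \o *%R b) 0.
  have := is_derive1_comp (is_derive_cos (b * 0)) (derive_mul b).
  by rewrite mulr0 sin0 oppr0 mul0r.
have := is_derive_at_right (is_deriveM (derive_exp a) dcos).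
by rewrite fctE /= !mulr0 expR0 cos0 !mulr1 scaler0 add0r scale1r.
Qed.

Lemma exp_sin_derivative a b :
  h^-1 * (expR (a * h) * sin (b * h)) @[h --> 0^'+] --> b.
Proof.
have dsin : is_derive (0 : R) (1 : R) (sin \o *%R b) b.
  have := is_derive1_comp (is_derive_sin (b * 0)) (derive_mul b).
  by rewrite mulr0 cos0 mul1r.
have := is_derive_at_right (is_deriveM (derive_exp a) dsin).
rewrite fctE /= !mulr0 expR0 sin0 !mul1r scale0r addr0 scale1r.
by under eq_fun do rewrite subr0.
Qed.

End exp_twist.

(** * The semigroup multiplied by a complex exponential *)

Section twist.
Context (R : realType) (V : normedModType R) (P : R -> {linear V -> V}) (a b : R).

(* [e^((a + i b) t) P_t] on the complexification, a pair [(u, v)] standing for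
   [u + i v]. *)
Definition twist (t : R) (w : V * V) : V * V :=
  rotation (expR (a * t) * cos (b * t)) (expR (a * t) * sin (b * t))
    (P t w.1, P t w.2).

Lemma twist_linear t : linear (twist t).
Proof.
move=> k u v; rewrite /twist -[RHS](linearP (rotation _ _)); congr (rotation _ _ _).
by rewrite /= !linearP.
Qed.

HB.instance Definition _ t :=
  GRing.isLinear.Build R (V * V)%type (V * V)%type _ (twist t) (twist_linear t).

Lemma twist_semigroup s t w :
  (forall f, P (s + t) f = P s (P t f)) -> twist (s + t) w = twist s (twist t w).
Proof.
move=> PD; rewrite /twist !PD !mulrDr expRD cosD sinD.
rewrite [X in _ = rotation _ _ X](_ : _ = rotation (expR (a * t) * cos (b * t))
  (expR (a * t) * sin (b * t)) (P s (P t w.1), P s (P t w.2))); last first.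
  by rewrite /rotation /= !linearB !linearD !linearZ.
rewrite rotationM; congr (rotation _ _ _); ring.
Qed.

Lemma twist0 w : (forall f, P 0 f = f) -> twist 0 w = w.
Proof.
move=> P0; rewrite /twist !mulr0 expR0 cos0 sin0 mul1r mulr0 !P0 -surjective_pairing.
exact: rotation10.
Qed.

Lemma norm_twist t w (m : R) : `|P t w.1| <= m -> `|P t w.2| <= m ->
  `|twist t w| <= 2 * expR (a * t) * m.
Proof.
move=> m1 m2; apply: le_trans (norm_rotation _ _ _) _.
apply: ler_pM => //; last by rewrite prod_normE ge_max m1.
rewrite !normrM ger0_norm ?expR_ge0// -mulrDr mulrC ler_wpM2r ?expR_ge0//.
by rewrite -[2]/(1 + 1) lerD// ler_norml ?cos_geN1 ?cos_le1 ?sin_geN1 ?sin_le1.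
Qed.

Let cvg_coef0 (f : R -> R) (l : R) : h^-1 * f h @[h --> 0^'+] --> l ->
  f h @[h --> 0^'+] --> 0.
Proof.
move=> fl; have : h * (h^-1 * f h) @[h --> 0^'+] --> 0 * l.
  apply: cvgM => //; apply: cvg_at_right_filter; exact: cvg_id.
rewrite mul0r; apply: cvg_trans; apply: near_eq_cvg; near=> h.
by rewrite mulrA divff ?mul1r// gt_eqF.
Unshelve. all: by end_near. Qed.

Lemma cvg_twist w : P h w.1 @[h --> 0^'+] --> w.1 -> P h w.2 @[h --> 0^'+] --> w.2 ->
  twist h w @[h --> 0^'+] --> w.
Proof.
move=> w1 w2; rewrite -[X in _ --> X]rotation10; apply: cvg_rotation.
- have -> : (fun h => expR (a * h) * cos (b * h)) =
      (fun h => 1 + (expR (a * h) * cos (b * h) - 1)).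
    by apply/funext => h; rewrite addrC subrK.
  rewrite -[X in _ --> X]addr0; apply: cvgD; first exact: cvg_cst.
  exact: cvg_coef0 (@exp_cos_derivative R a b).
- exact: cvg_coef0 (@exp_sin_derivative R a b).
- by rewrite [X in _ --> X]surjective_pairing; exact: cvg_pair.
Qed.

Lemma difference_quotient_twist w g1 g2 :
  P h w.1 @[h --> 0^'+] --> w.1 -> P h w.2 @[h --> 0^'+] --> w.2 ->
  difference_quotient P w.1 h @[h --> 0^'+] --> g1 ->
  difference_quotient P w.2 h @[h --> 0^'+] --> g2 ->
  difference_quotient twist w h @[h --> 0^'+] --> rotation a b w + (g1, g2).
Proof.
move=> Pw1 Pw2 w1 w2; apply: rotation_difference_quotient.
- exact: exp_cos_derivative.
- exact: exp_sin_derivative.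
- by rewrite [X in _ --> X]surjective_pairing; exact: cvg_pair.
- exact: cvg_pair.
Qed.

End twist.

(** Multiplication by [e^(-(a + i b) t)] undoes the twist; this carries differentiability back from
    the twist to [P]. *)
Lemma twistK (R : realType) (V : normedModType R) (P : R -> {linear V -> V})
    (a b t : R) (w : V * V) :
  rotation (expR (- a * t) * cos (- b * t)) (expR (- a * t) * sin (- b * t))
    (twist P a b t w) = (P t w.1, P t w.2).
Proof.
rewrite /twist rotationM !mulNr cosN sinN.
have e1 := expRxMexpNx_1 (a * t); have c1 := cos2Dsin2 (b * t).
rewrite -[RHS]rotation10; congr (rotation _ _ _).
  transitivity (expR (a * t) * expR (- (a * t)) * (cos (b * t) ^+ 2 + sin (b * t) ^+ 2)).
    ring.
  by rewrite e1 c1 mulr1.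
ring.
Qed.

(** Solving the resolvent equation only yields a vector in the domain of the twisted generator. The
    product rule applied to [e^(-(a + i b) t)] times the twist puts both components in the domain of
    the generator of [P]. *)
Lemma difference_quotient_untwist (R : realType) (V : normedModType R)
    (P : R -> {linear V -> V}) (a b : R) (w z : V * V) :
  P h w.1 @[h --> 0^'+] --> w.1 -> P h w.2 @[h --> 0^'+] --> w.2 ->
  difference_quotient (twist P a b) w h @[h --> 0^'+] --> z ->
  exists g1 g2, [/\ difference_quotient P w.1 h @[h --> 0^'+] --> g1,
    difference_quotient P w.2 h @[h --> 0^'+] --> g2 &
    z = rotation a b w + (g1, g2)].
Proof.
move=> Pw1 Pw2 zw; pose g := rotation (- a) (- b) w + z.
have : h^-1 *: ((P h w.1, P h w.2) - w) @[h --> 0^'+] --> g.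
  under eq_fun do rewrite -(twistK P a b).
  apply: rotation_difference_quotient => //.
  - exact: exp_cos_derivative.
  - exact: exp_sin_derivative.
  - exact: cvg_twist.
move=> gw; exists g.1, g.2.
have g1 : difference_quotient P w.1 h @[h --> 0^'+] --> g.1.
  by have := cvg_comp _ _ gw (@cvg_fst _ _ _ _ _); exact.
have g2 : difference_quotient P w.2 h @[h --> 0^'+] --> g.2.
  by have := cvg_comp _ _ gw (@cvg_snd _ _ _ _ _); exact.
split => //; rewrite -surjective_pairing /g addrA.
suff -> : rotation a b w + rotation (- a) (- b) w = 0 by rewrite add0r.
by rewrite /rotation !scaleNr; congr (_, _) => /=;
  rewrite ?opprK addrACA addrC ?subrr ?addNr addr0.
Qed.

(** * Resolvent of a delayed exponentially contractive semigroup *)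

Section spectral.
Context (R : realType) (V : normedModType R).

(** The decay and completeness arguments run in the maximum norm of [V * V], whereas [resolvent_set]
    uses the Euclidean one; this bound and the next translate between them. *)
Lemma norm_le_complexification (w : V * V) : `|w| <= complexification_norm w.
Proof.
have s0 : 0 <= `|w.1| ^+ 2 + `|w.2| ^+ 2 by rewrite addr_ge0.
rewrite prod_normE ge_max /complexification_norm; apply/andP; split.
  by rewrite -(ler_pXn2r (n := 2)) ?nnegrE// sqr_sqrtr// lerDl.
by rewrite -(ler_pXn2r (n := 2)) ?nnegrE// sqr_sqrtr// lerDr.
Qed.

Lemma complexification_norm_le (w : V * V) : complexification_norm w <= 2 * `|w|.
Proof.
have w1 : `|w.1| <= `|w| by rewrite prod_normE le_max lexx.
have w2 : `|w.2| <= `|w| by rewrite prod_normE le_max lexx orbT.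
rewrite /complexification_norm -(ler_pXn2r (n := 2)) ?nnegrE// ?mulr_ge0//.
rewrite sqr_sqrtr ?addr_ge0//.
have := normr_ge0 w.1; have := normr_ge0 w.2; nra.
Qed.

Lemma seq_complete_prod (H : set V) :
  seq_complete H -> seq_complete [set w : V * V | H w.1 /\ H w.2].
Proof.
move=> Hc u Hu uC.
have n1 (w : V * V) : `|w.1| <= `|w| by rewrite prod_normE le_max lexx.
have n2 (w : V * V) : `|w.2| <= `|w| by rewrite prod_normE le_max lexx orbT.
have [|e e0|l1 Hl1 ul1] := Hc (fun n => (u n).1).
- by move=> n; case: (Hu n).
- have [n0 hn0] := uC e e0; exists n0 => m n hm hn.
  exact: le_trans (n1 (u m - u n)) (hn0 m n hm hn).
have [|e e0|l2 Hl2 ul2] := Hc (fun n => (u n).2).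
- by move=> n; case: (Hu n).
- have [n0 hn0] := uC e e0; exists n0 => m n hm hn.
  exact: le_trans (n2 (u m - u n)) (hn0 m n hm hn).
exists (l1, l2) => // e e0; have [m1 h1] := ul1 e e0; have [m2 h2] := ul2 e e0.
exists (maxn m1 m2) => n; rewrite geq_max => /andP[k1 k2].
by rewrite prod_normE ge_max h1//= h2.
Qed.

Lemma difference_quotientB (W : normedModType R) (Q : R -> {linear W -> W}) f g h :
  difference_quotient Q (f - g) h = difference_quotient Q f h - difference_quotient Q g h.
Proof.
rewrite /difference_quotient -scalerBr (linearB (Q h)) !opprB; congr (_ *: _).
by rewrite !addrA [RHS](ACl (1*4*3*2)).
Qed.

Variables (P : R -> {linear V -> V}) (H : set V) (nu S : R).
Hypothesis P0 : forall f, P 0 f = f.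
Hypothesis PD : forall s t f, 0 <= s -> 0 <= t -> P (s + t) f = P s (P t f).
Hypothesis Pc : forall f, P t f @[t --> 0^'+] --> f.
Hypothesis H_0 : H 0.
Hypothesis HZD : forall a f g, H f -> H g -> H (a *: f + g).
Hypothesis HP : forall t f, 0 <= t -> H f -> H (P t f).
Hypothesis H_complete : seq_complete H.
Hypothesis H_generator : forall f g, H f ->
  difference_quotient P f h @[h --> 0^'+] --> g -> H g.
Hypothesis P_delayed : forall t f, 0 <= t -> H f ->
  `|P t f| <= expR (- nu * (t - S)) * `|f|.

(** The operator [a - (-L) = a + L] generates [Q t = e^(a t) P t], which decays at rate
    [nu - Re a > 0]. Decay bounds [a + L] from below, giving injectivity and the bounded inverse;
    Riemann sums give surjectivity. *)
Lemma delayed_resolvent (a : R[i]) : complex.Re a < nu ->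
  resolvent_set H (H `&` generator_dom P) (fun f => - generator P f) a.
Proof.
move=> anu; pose HC := [set w : V * V | H w.1 /\ H w.2].
pose Q := twist P (complex.Re a) (complex.Im a).
have QD s t w : 0 <= s -> 0 <= t -> Q (s + t) w = Q s (Q t w).
  by move=> s0 t0; apply: twist_semigroup => f; exact: PD.
have Q0 w : Q 0 w = w by exact: twist0.
have HC0 : HC 0 by [].
have HCZD k u v : HC u -> HC v -> HC (k *: u + v).
  by move=> [? ?] [? ?]; split; exact: HZD.
have HB u v : HC u -> HC v -> HC (u - v).
  by move=> Hu Hv; rewrite addrC -scaleN1r; exact: HCZD.
have HCQ t w : 0 <= t -> HC w -> HC (Q t w).
  move=> t0 [w1 w2]; split => /=.
    rewrite -scaleNr addrC; apply: HZD; first exact: HP.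
    by rewrite -[_ *: _]addr0; apply: HZD => //; exact: HP.
  apply: HZD; first exact: HP.
  by rewrite -[_ *: _]addr0; apply: HZD => //; exact: HP.
have Qc w : HC w -> Q t w @[t --> 0^'+] --> w by move=> _; apply: cvg_twist; exact: Pc.
(* The 2 bounds [|cos| + |sin|], and the exponential comes from the delay. *)
pose K := 2 * expR (nu * S).
have K0 : 0 <= K by rewrite mulr_ge0// expR_ge0.
have d0 : 0 < nu - complex.Re a by rewrite subr_gt0.
have Qnu t w : 0 <= t -> HC w ->
    `|Q t w| <= K * expR (- (nu - complex.Re a) * t) * `|w|.
  move=> t0 [w1 w2].
  have e0 := expR_ge0 (- nu * (t - S)).
  have n1 : `|P t w.1| <= expR (- nu * (t - S)) * `|w|.
    apply: le_trans (P_delayed t0 w1) _.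
    by rewrite ler_wpM2l// prod_normE le_max lexx.
  have n2 : `|P t w.2| <= expR (- nu * (t - S)) * `|w|.
    apply: le_trans (P_delayed t0 w2) _.
    by rewrite ler_wpM2l// prod_normE le_max lexx orbT.
  apply: le_trans (norm_twist _ _ n1 n2) _.
  rewrite mulrA ler_wpM2r// /K -!mulrA -!expRD le_eqVlt; apply/predU1l.
  congr (_ * expR _); ring.
pose Sa (w : V * V) : V * V :=
  rotation (complex.Re a) (complex.Im a) w + (generator P w.1, generator P w.2).
have SE w : a *: (w : complexification V) -
    complexify_op (fun f => - generator P f) w = Sa w.
  by rewrite /Sa /complexify_op; congr (_, _) => /=; rewrite opprK.
have dqS w : generator_dom P w.1 -> generator_dom P w.2 ->
    difference_quotient Q w h @[h --> 0^'+] --> Sa w.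
  by move=> w1 w2; apply: difference_quotient_twist; try exact: Pc.
have bound w z : HC w -> difference_quotient Q w h @[h --> 0^'+] --> z ->
    `|w| <= K / (nu - complex.Re a) * `|z|.
  move=> Hw; exact: (decay_generator_le QD HB HCQ (@ler_normD _ _) d0 K0 Q0 Qnu Hw).
have dqB w w' z z' : difference_quotient Q w h @[h --> 0^'+] --> z ->
    difference_quotient Q w' h @[h --> 0^'+] --> z' ->
    difference_quotient Q (w - w') h @[h --> 0^'+] --> z - z'.
  by move=> wz wz'; under eq_fun do rewrite difference_quotientB; exact: cvgB.
have HZ k f : H f -> H (k *: f) by move=> Hf; rewrite -[_ *: _]addr0; exact: HZD.
have HD f g : H f -> H g -> H (f + g) by move=> Hf Hg; rewrite -[f]scale1r; exact: HZD.
split.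
  split.
  - move=> w [[w1 d1] [w2 d2]]; rewrite /= SE.
    split; rewrite /Sa /=; apply: (HD).
    + by rewrite -scaleNr; apply: (HD); exact: HZ.
    + exact: H_generator w1 d1.
    + by apply: (HD); exact: HZ.
    + exact: H_generator w2 d2.
  (* Two preimages of the same vector differ by a vector on which the twisted generator vanishes,
     and [bound] makes that difference 0. *)
  - move=> w w' /set_mem[[w1 d1] [w2 d2]] /set_mem[[w1' d1'] [w2' d2']].
    rewrite /= !SE => Sww'; apply/eqP; rewrite -subr_eq0 -normr_le0.
    have := dqB _ _ _ _ (dqS w d1 d2) (dqS w' d1' d2'); rewrite Sww' subrr.
    by move/bound; rewrite normr0 mulr0; apply; exact: HB.
  - move=> f [f1 f2].
    (* [resolvent_onto] produces minus its argument, hence the sign. *)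
    have HNf : HC (- f) by split => /=; rewrite -scaleN1r; exact: HZ.
    have [u [u1 u2]] := resolvent_onto Q0 QD Qc HC0 HCZD HCQ
      (seq_complete_prod H_complete) K0 d0 Qnu HNf.
    rewrite opprK => uf.
    have [g1 [g2 [ug1 ug2 fE]]] :=
      difference_quotient_untwist (@Pc u.1) (@Pc u.2) uf.
    have d1 : generator_dom P u.1 by apply/cvg_ex; exists g1.
    have d2 : generator_dom P u.2 by apply/cvg_ex; exists g2.
    exists u; first by split; split.
    rewrite SE; apply: (cvg_unique _ (dqS u d1 d2) uf); exact: norm_hausdorff.
exists (2 * (K / (nu - complex.Re a))) => w [[w1 d1] [w2 d2]]; rewrite SE.
apply: le_trans (complexification_norm_le _) _; rewrite -mulrA ler_pM2l//.
apply: le_trans (bound w _ (conj w1 w2) (dqS w d1 d2)) _.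
by rewrite ler_wpM2l ?norm_le_complexification// divr_ge0// ltW.
Qed.

End spectral.

(** * Completeness of L^2 *)

Section L2_facts.
Context d (X : measurableType d) (R : realType) (mu : probability X R).
Implicit Types (u v : L2 mu).

Lemma measurable_L2 u : measurable_fun [set: X] u.
Proof. exact: measurable_funPT. Qed.

Lemma L2_ZD_ae a u v : ae_eq mu setT (a *: u + v : L2 mu) (fun x => a * u x + v x).
Proof.
have -> : a *: u + v = L2_of (a *: L2_repr u + L2_repr v).
  by rewrite L2_ofD L2_ofZ !L2_reprK.
exact: L2_repr_of.
Qed.

Lemma L2_normsq u : (\int[mu]_x ((u x) ^+ 2)%:E = (`|u| ^+ 2)%:E)%E.
Proof.
have n2 : 2 != 0 :> R by rewrite pnatr_eq0.
have := powR_Lnorm mu (EFin \o u) n2.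
rewrite -[X in poweR X _](finite_norm_fine (L2_repr u)) -L2_normr.
rewrite poweR_EFin powR_mulrn// => ->; apply: eq_integral => x _ /=.
by rewrite powR_mulrn// real_normK// num_real.
Qed.

Lemma integrable_L2 u : mu.-integrable setT (EFin \o u).
Proof.
apply/Lfun1_integrable; apply: Lfun_subset12; last exact: LfunP.
by rewrite fin_num_measure.
Qed.

Definition L2_mean u : R := fine (\int[mu]_x (u x)%:E).

Lemma L2_meanE u : (\int[mu]_x (u x)%:E = (L2_mean u)%:E)%E.
Proof. by rewrite fineK// integrable_fin_num//; exact: integrable_L2. Qed.

Lemma L20P u : L20 u <-> L2_mean u = 0.
Proof. by rewrite /L20 /= L2_meanE; split=> [[]|->]. Qed.

Lemma L2_meanZD a u v : L2_mean (a *: u + v) = a * L2_mean u + L2_mean v.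
Proof.
apply: EFin_inj; rewrite -L2_meanE EFinD EFinM -!L2_meanE.
have iau : mu.-integrable setT (fun x => (a%:E * (u x)%:E)%E).
  by apply: integrableZl => //; exact: integrable_L2.
rewrite -integralZl//; last exact: integrable_L2.
rewrite -integralD//; last exact: integrable_L2.
apply: ae_eq_integral => //.
- by apply/measurable_EFinP; exact: measurable_L2.
- apply/measurable_EFinP; apply: measurable_funD; last exact: measurable_L2.
  by apply: measurable_funM => //; exact: measurable_L2.
- by have := L2_ZD_ae a u v; apply: filterS => x /[apply] ->.
Qed.

(** Hoelder's inequality against the constant 1, which has norm 1 for a probability measure. *)
Lemma L2_norm1_le u : (\int[mu]_x (`|u x|)%:E <= (`|u|)%:E)%E.
Proof.
have N1 : 'N[mu]_2%:E[cst 1]%E = 1%E.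
  rewrite Lnorm_cst1 -[RHS](poweR1r 2^-1); congr (poweR _ _).
  exact: probability_setT.
have := @hoelder _ X R mu u (cst 1) 2 2.
rewrite Lnorm1 (_ : EFin \o cst 1 = cst 1%E)// N1.
rewrite mule1 -(finite_norm_fine (L2_repr u)) -L2_normr.
under eq_integral do rewrite /= mulr1.
by apply => //; rewrite -[2^-1]mul1r -splitr.
Qed.

Lemma L2_mean_le u : `|L2_mean u| <= `|u|.
Proof.
rewrite -lee_fin; apply: le_trans (L2_norm1_le u).
rewrite -abse_EFin -L2_meanE.
by apply: le_abse_integral => //; apply/measurable_EFinP; exact: measurable_L2.
Qed.


Lemma L2_normsq_sub u v :
  (\int[mu]_x ((u x - v x) ^+ 2)%:E = (`|u - v| ^+ 2)%:E)%E.
Proof.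
rewrite -L2_normsq; apply: ae_eq_integral => //.
- apply/measurable_EFinP; apply: measurable_funX.
  by apply: measurable_funB; exact: measurable_L2.
- by apply/measurable_EFinP; apply: measurable_funX; exact: measurable_L2.
- have := L2_ZD_ae (-1) v u; apply: filterS => x /[apply].
  by rewrite scaleN1r addrC mulN1r [- _ + _]addrC => ->.
Qed.

Lemma L2_norm1_sub_le u v : (\int[mu]_x (`|u x - v x|)%:E <= (`|u - v|)%:E)%E.
Proof.
apply: le_trans (L2_norm1_le (u - v)); rewrite le_eqVlt; apply/orP; left; apply/eqP.
apply: ae_eq_integral => //.
- apply/measurable_EFinP; apply: measurableT_comp => //.
  by apply: measurable_funB; exact: measurable_L2.
- by apply/measurable_EFinP; apply: measurableT_comp => //; exact: measurable_L2.
- have := L2_ZD_ae (-1) v u; apply: filterS => x /[apply].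
  by rewrite scaleN1r addrC mulN1r [- _ + _]addrC => ->.
Qed.

(** The sum of [|v (k+1) - v k|] has finite integral, bounded by a geometric series, so it is finite
    almost everywhere; there the telescoping series converges absolutely. *)
Lemma L2_fast_cauchy_cvg_ae (v : nat -> L2 mu) :
  (forall k, `|v k.+1 - v k| <= 1 / (2 ^ (k + 1))%:R) ->
  {ae mu, forall x, cvgn (fun k => v k x)}.
Proof.
move=> vC; pose D k x := (`|v k.+1 x - v k x|)%:E.
have mD k : measurable_fun setT (D k).
  apply/measurable_EFinP; apply: measurableT_comp => //.
  by apply: measurable_funB; exact: measurable_L2.
have D0 k x : setT x -> (0 <= D k x)%E by rewrite lee_fin.
have iD : mu.-integrable setT (fun x => \sum_(0 <= k <oo) D k x)%E.
  apply/integrableP; split.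
    apply: (eq_measurable_fun (fun x => limn_esup (fun n => \sum_(0 <= k < n) D k x)))%E.
      move=> x _; apply: is_cvg_limn_esupE; apply: is_cvg_nneseries => k _ _.
      exact: D0.
    by apply: measurable_fun_limn_esup => n; apply: emeasurable_sum.
  rewrite (@eq_integral _ _ _ mu setT (fun x => \sum_(0 <= k <oo) D k x))%E; last first.
    by move=> x _; rewrite gee0_abs//; apply: nneseries_ge0 => k _ _; exact: D0.
  rewrite integral_nneseries//.
  apply: (@le_lt_trans _ _ (\sum_(0 <= k <oo) (1 / (2 ^ (k + 1))%:R)%:E)%E).
    apply: lee_nneseries => [k _ _|k _]; first by apply: integral_ge0 => x; exact: D0.
    by apply: le_trans (L2_norm1_sub_le _ _) _; rewrite lee_fin.
  by have /cvg_lim -> := @cvg_geometric_eseries_half R 1 0; rewrite ?ltry.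
have := integrable_ae measurableT iD; apply: filterS => x /(_ Logic.I) fx.
pose w k := v k x.
have : cvgn (series (fun k => `|w k.+1 - w k|)).
  apply: nondecreasing_is_cvgn.
    by apply: nondecreasing_series => *; exact: normr_ge0.
  exists (fine (\sum_(0 <= k <oo) D k x)%E) => _ [n _ <-].
  rewrite -lee_fin fineK//.
  rewrite /series /= -sumEFin.
  by apply: nneseries_lim_ge => k *.
move=> /(normed_cvg (u_ := fun k => w k.+1 - w k)) wc.
have -> : (fun k => v k x) = (fun n => w 0%N + series (fun k => w k.+1 - w k) n).
  by apply/funext => n; rewrite seriesEnat /= telescope_sumr// addrC subrK.
by apply: is_cvgD => //; exact: is_cvg_cst.
Qed.

End L2_facts.

(** * The Riesz-Fischer theorem and the closed subspace of mean zero *)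

Section L2_complete.
Context d (X : measurableType d) (R : realType) (mu : probability X R).

Lemma L2_fatou (v : nat -> L2 mu) (f : X -> R) (u : L2 mu) (e : R) k0 :
  measurable_fun setT f -> {ae mu, forall x, v k x @[k --> \oo] --> f x} ->
  (forall k, (k0 <= k)%N -> `|v k - u| <= e) ->
  (\int[mu]_x ((f x - u x) ^+ 2)%:E <= (e ^+ 2)%:E)%E.
Proof.
move=> mf vf vu; pose G k x := ((v k x - u x) ^+ 2)%:E.
have mG k : measurable_fun setT (G k).
  apply/measurable_EFinP; apply: measurable_funX.
  by apply: measurable_funB; exact: measurable_L2.
have mfu : measurable_fun setT (fun x => ((f x - u x) ^+ 2)%:E).
  apply/measurable_EFinP; apply: measurable_funX.
  by apply: measurable_funB => //; exact: measurable_L2.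
have Gf : {ae mu, forall x, G k x @[k --> \oo] --> ((f x - u x) ^+ 2)%:E}.
  move: vf; apply: filterS => x vfx; apply: cvg_EFin; first by near=> k.
  have -> : fine \o G ^~ x = fun k => (v k x - u x) ^+ 2 by [].
  rewrite expr2; under eq_fun do rewrite expr2.
  have : v k x - u x @[k --> \oo] --> f x - u x.
    by apply: cvgB => //; exact: cvg_cst.
  by move=> h; apply: cvgM.
(* The limit is exchanged for the upper limit, which is measurable, and then for the lower limit, to
   which Fatou's lemma applies. *)
rewrite (@ae_eq_integral _ _ _ mu setT (fun x => limn_esup (G^~ x)))//; last first.
- move: Gf; apply: filterS => x /cvg_limn_einf_sup[_ ->] //.
- by apply: measurable_fun_limn_esup.
rewrite (@ae_eq_integral _ _ _ mu setT (fun x => limn_einf (G^~ x)))//; last 3 first.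
- by apply: measurable_fun_limn_esup.
- under eq_fun => x do rewrite -[limn_einf _]oppeK -limn_esupN.
  apply: measurableT_comp => //; apply: measurable_fun_limn_esup => k.
  exact: measurableT_comp.
- by move: Gf; apply: filterS => x /cvg_limn_einf_sup[-> ->].
apply: le_trans (fatou _ _ _ _) _ => // [n x _|].
  by rewrite lee_fin sqr_ge0.
rewrite limn_einf_lim; apply: lime_le; first exact: is_cvg_einfs.
(* The infimum over a tail is at most the term of index [maxn n k0], where the bound [e] is
   available. *)
near=> n; apply: ge_ereal_inf; exists (\int[mu]_x G (maxn n k0) x)%E.
  by exists (maxn n k0) => //=; exact: leq_maxl.
rewrite /G L2_normsq_sub lee_fin ler_pXn2r ?nnegrE//.
- by apply: vu; exact: leq_maxr.
- exact: le_trans (normr_ge0 _) (vu k0 (leqnn _)).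
Unshelve. all: by end_near. Qed.

(** A rapidly Cauchy subsequence has an almost everywhere limit [f]; Fatou's lemma bounds [f - v k]
    in norm, so the limit is attained in [L2], and the Cauchy property extends this to the full
    sequence. *)
Lemma L2_seq_complete : seq_complete [set: L2 mu].
Proof.
move=> u _ uC; pose e k : R := 1 / (2 ^ (k + 1))%:R.
have e0 k : 0 < e k by rewrite divr_gt0// ltr0n expn_gt0.
have [N hN] := choice (fun k => uC (e k) (e0 k)).
(* Partial sums dominate every earlier threshold, so [n_ j >= N k] for all [k <= j]. *)
pose n_ k := (\sum_(i < k.+1) N i)%N.
have Nn k j : (k <= j)%N -> (N k <= n_ j)%N.
  by move=> kj; rewrite /n_ (bigD1 (Ordinal (kj : k < j.+1)%N)) //= leq_addr.
pose v k : L2 mu := u (n_ k).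
have vC j k : (k <= j)%N -> `|v j - v k| <= e k.
  by move=> kj; apply: hN; exact: Nn.
have vcvg : {ae mu, forall x, cvgn (fun k => v k x)}.
  by apply: L2_fast_cauchy_cvg_ae => k; apply: vC.
(* The upper limit gives a measurable function defined also where the subsequence diverges. *)
pose f x := fine (limn_esup (fun k => (v k x)%:E)).
have mf : measurable_fun setT f.
  apply: measurableT_comp => //; apply: measurable_fun_limn_esup => k.
  by apply/measurable_EFinP; exact: measurable_L2.
have vf : {ae mu, forall x, v k x @[k --> \oo] --> f x}.
  move: vcvg; apply: filterS => x /cvg_ex[l vl].
  rewrite /f; have /cvg_limn_einf_sup[_ ->] : (v k x)%:E @[k --> \oo] --> l%:E.
    by apply: cvg_EFin => //; near=> k.
  exact: vl.
have fv k : (\int[mu]_x ((f x - v k x) ^+ 2)%:E <= ((e k) ^+ 2)%:E)%E.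
  by apply: (L2_fatou mf vf (k0 := k)) => j; exact: vC.
have fL k : (fun x => f x - v k x) \in Lfun mu 2%:E.
  rewrite inE; apply/andP; split; rewrite inE /=.
    by apply: measurable_funB => //; exact: measurable_L2.
  rewrite /finite_norm; apply: (@lty_poweRy _ _ 2); first by rewrite pnatr_eq0.
  rewrite powR_Lnorm ?pnatr_eq0//; apply: le_lt_trans (ltry (e k ^+ 2)).
  apply: le_trans (fv k); rewrite le_eqVlt; apply/orP; left; apply/eqP.
  by apply: eq_integral => x _ /=; rewrite powR_mulrn// real_normK// num_real.
(* The class of [f - v k]; the class of [f] is then [w k + v k] for any [k], in particular for
   [k = 0]. *)
pose w k : L2 mu := L2_of (Lfun_Sub (lee1n 2) (fL k)).
have w_le k : `|w k| <= e k.
  rewrite -(ler_pXn2r (n := 2))// ?nnegrE//; last exact: ltW.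
  rewrite -lee_fin -L2_normsq; apply: le_trans (fv k).
  rewrite le_eqVlt; apply/orP; left; apply/eqP; apply: ae_eq_integral => //.
  - by apply/measurable_EFinP; apply: measurable_funX; exact: measurable_L2.
  - apply/measurable_EFinP; apply: measurable_funX.
    by apply: measurable_funB => //; exact: measurable_L2.
  - have := L2_repr_of (Lfun_Sub (lee1n 2) (fL k)).
    by apply: filterS => x /[apply] h; congr (_ ^+ 2)%:E; exact: h.
have wv k : w k + v k = w 0%N + v 0%N.
  rewrite -[v k]L2_reprK -[v 0%N]L2_reprK -!L2_ofD; apply/L2_ofP/aeW => x _ /=.
  by rewrite /= !subrK.
exists (w 0%N + v 0%N) => // r r0.
(* Then [1/r < k + 1 <= 2^k], while [e k + e k = 2^(-k)]. *)
pose k := Num.truncn r^-1.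
have ek : e k + e k <= r.
  have -> : e k + e k = (2 ^ k)%:R^-1.
    rewrite /e addn1 expnSr natrM; set a := (2 ^ k)%:R; have a0 : a != 0.
      by rewrite pnatr_eq0 -lt0n expn_gt0.
    by field.
  rewrite invf_ple ?posrE ?ltr0n ?expn_gt0//; apply: le_trans (ltW (truncnS_gt _)) _.
  by rewrite ler_nat ltn_expl.
exists (maxn (N k) (n_ k)) => n; rewrite geq_max => /andP[Nkn _].
rewrite -(wv k) opprD addrA [u n - _ - _]addrAC.
apply: le_trans (ler_normB _ _) (le_trans (lerD _ (w_le k)) ek).
by apply: hN => //; exact: Nn.
Unshelve. all: by end_near. Qed.

(** The mean is 1-Lipschitz for the norm of [L2], so mean zero passes to the limit. *)
Lemma L20_seq_complete : seq_complete (@L20 _ _ _ mu).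
Proof.
move=> u u0 uC; have [//|l _ ul] := L2_seq_complete (u := u) _ uC.
exists l => //; apply/L20P/eqP; rewrite -normr_le0; apply/ler_addgt0Pr => r r0.
have [n /(_ n (leqnn n)) un] := ul r r0.
rewrite add0r; apply: le_trans un; rewrite distrC.
have -> : L2_mean l = L2_mean (l - u n).
  have /L20P un0 := u0 n.
  by rewrite addrC -scaleN1r L2_meanZD un0 mulr0 add0r.
exact: L2_mean_le.
Qed.
End L2_complete.

(** * Contractivity in average *)

Section continuous_integral.
Context (R : realType).
Notation leb := (@lebesgue_measure R).

Lemma continuous_itv_integrable (G : R -> R) (x y : R) :
  continuous G -> leb.-integrable `[x, y] (EFin \o G).
Proof.
move=> cG; apply: continuous_compact_integrable; first exact: segment_compact.
exact: continuous_subspaceT.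
Qed.

(** Moves an averaging window back to time 0, where the semigroup law reads it as a window for
    [P t f]. *)
Lemma integral_shift (G : R -> R) (t r : R) : 0 <= r -> continuous G ->
  (\int[leb]_(x in `[t, (t + r)%R]) (G x)%:E =
   \int[leb]_(x in `[0%R, r]) (G (x + t)%R)%:E)%E.
Proof.
move=> r0 cG; pose F (x : R) := x + t.
have dF (x : R) : is_derive x (1 : R) F 1.
  by have := is_deriveD (is_derive_id x (1 : R)) (is_derive_cst t x (1 : R));
    rewrite addr0.
have F1 : derive1 F = cst 1 by apply/funext => x; rewrite derive1E derive_val.
have cF : continuous F.
  by move=> x; apply: differentiable_continuous; apply/derivable1_diffP; case: (dF x).
have -> : t = F 0 by rewrite /F add0r.
have -> : F 0 + r = F r by rewrite /F add0r addrC.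
rewrite integration_by_substitution_increasing//.
- by apply: eq_integral => x _; rewrite fctE F1 /= mulr1 /F add0r.
- by move=> x y _ _ xy; rewrite /F ltrD2r.
- by move=> x _; rewrite F1; exact: cst_continuous.
- by rewrite F1; exact: is_cvg_cst.
- by rewrite F1; exact: is_cvg_cst.
- split.
  + by move=> x _; case: (dF x).
  + by apply: cvg_at_right_filter; exact: cF.
  + by apply: cvg_at_left_filter; exact: cF.
- exact: continuous_subspaceT.
Qed.

Lemma lebesgue_integral_id (r : R) : 0 < r ->
  (\int[leb]_(x in `[0%R, r]) x%:E = (r ^+ 2 / 2)%:E)%E.
Proof.
move=> r0; pose F (x : R) := 2^-1 * (x * x).
have dF (x : R) : is_derive x (1 : R) F x.
  have d2 := is_deriveM (is_derive_id x (1 : R)) (is_derive_id x (1 : R)).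
  apply: (is_derive_eq (is_deriveZ 2^-1 d2)).
  by rewrite /GRing.scale /=; field.
have cF : continuous F.
  by move=> x; apply: differentiable_continuous; apply/derivable1_diffP; case: (dF x).
rewrite (@continuous_FTC2 _ idfun F)//.
- by rewrite /F !mul0r mulr0 sube0 mulrC expr2.
- by apply: continuous_subspaceT => x; exact: cvg_id.
- split.
  + by move=> x _; case: (dF x).
  + by apply: cvg_at_right_filter; exact: cF.
  + by apply: cvg_at_left_filter; exact: cF.
- by move=> x _; rewrite derive1E derive_val.
Qed.

End continuous_integral.

(** * Lower bounds for the generator of a contraction semigroup *)

Section contraction_semigroup.
Context (R : realType) (V : normedModType R) (P : R -> {linear V -> V}).
Hypothesis cP : c0_contraction_semigroup P.
Implicit Types (f g : V) (s t : R).

Let PD s t f : 0 <= s -> 0 <= t -> P (s + t) f = P s (P t f).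
Proof. exact: semigroupD cP s t f. Qed.

Let P0 f : P 0 f = f.
Proof. exact: semigroup0 cP f. Qed.

Let Pcontr t f : 0 <= t -> `|P t f| <= `|f|.
Proof. exact: semigroup_contraction cP t f. Qed.

Lemma semigroup_norm_nonincreasing s t f : 0 <= s -> s <= t -> `|P t f| <= `|P s f|.
Proof.
move=> s0 st; have -> : t = (t - s) + s by rewrite subrK.
by rewrite PD ?subr_ge0//; apply: Pcontr; rewrite subr_ge0.
Qed.

(** Differentiability is known only at time 0. Cutting [[0, t]] into short steps of length [h], each
    step moves the orbit by at most [h (|g| + e / t)] by contractivity, and the errors total [e]. *)
Lemma semigroup_sub_le f g t : 0 <= t ->
  difference_quotient P f h @[h --> 0^'+] --> g -> `|f - P t f| <= t * `|g|.
Proof.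
rewrite le_eqVlt => /predU1P[<- _|t0 fg]; first by rewrite P0 subrr normr0 mul0r.
apply/ler_addgt0Pr => e e0.
have [d d0 de] := (cvg_at_right0P _ _).1 fg (e / t) (divr_gt0 e0 t0).
pose n := (Num.truncn (t / d)).+1; pose h := t / n%:R.
have n0 : 0 < n%:R :> R by rewrite ltr0n.
have h0 : 0 < h by rewrite divr_gt0.
have hd : h < d.
  by rewrite /h ltr_pdivrMr// mulrC -ltr_pdivrMr// truncnS_gt.
have hn : h * n%:R = t by rewrite /h divfK// gt_eqF.
have step m : `|f - P (h * m%:R) f| <= h * m%:R * (`|g| + e / t).
  elim: m => [|m IHm]; first by rewrite mulr0 P0 subrr normr0 mul0r.
  have hm0 : 0 <= h * m%:R by rewrite mulr_ge0// ltW.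
  have -> : f - P (h * m.+1%:R) f = (f - P (h * m%:R) f) + P (h * m%:R) (f - P h f).
    by rewrite linearB /= -PD ?(ltW h0)// -natr1 mulrDr mulr1 addrA subrK.
  apply: le_trans (ler_normD _ _) _; rewrite -natr1 [h * (_ + _)]mulrDr mulr1 mulrDl.
  apply: lerD => //; apply: le_trans (Pcontr _ hm0) _.
  have dq : `|difference_quotient P f h| <= `|g| + e / t.
    rewrite -[difference_quotient _ _ _](subrK g) addrC.
    by apply: le_trans (ler_normD _ _) _; rewrite lerD2l; apply: de; rewrite h0.
  rewrite -ler_pdivrMl//; apply: le_trans dq.
  by rewrite /difference_quotient normrZ gtr0_norm ?invr_gt0// distrC.
by have := step n; rewrite hn mulrDr mulrCA divff ?gt_eqF// mulr1.
Qed.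

(* Cut off at [0], since [P] is unspecified at negative times, so as to be
   continuous on the whole line. *)
Definition orbit_norm f s : R := `|P (Num.max s 0) f|.

Lemma orbit_normE f s : 0 <= s -> orbit_norm f s = `|P s f|.
Proof. by move=> s0; rewrite /orbit_norm max_l. Qed.

Lemma orbit_norm_shift f t s : 0 <= s -> 0 <= t ->
  orbit_norm f (s + t) = orbit_norm (P t f) s.
Proof. by move=> s0 t0; rewrite !orbit_normE ?addr_ge0// PD. Qed.

(** For [a <= b], contractivity gives [|P a f - P b f| <= |f - P (b - a) f|], so continuity at 0 is
    uniform along the orbit; the cutoff at 0 is 1-Lipschitz. *)
Lemma continuous_orbit_norm f : continuous (orbit_norm f).
Proof.
move=> s; apply/cvgrPdist_le => e e0.
have [d d0 de] := (cvg_at_right0P _ _).1 (@semigroup_continuous _ _ _ cP f) e e0.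
have sub a b : 0 <= a -> a <= b -> `|b - a| < d -> `| `|P a f| - `|P b f| | <= e.
  move=> a0 ab bad; apply: le_trans (ler_dist_dist _ _) _.
  have -> : P b f = P a (P (b - a) f) by rewrite -PD ?subr_ge0// addrC subrK.
  rewrite -linearB; apply: le_trans (Pcontr _ a0) _.
  move: ab; rewrite le_eqVlt => /predU1P[->|ab].
    by rewrite subrr P0 subrr normr0 ltW.
  rewrite distrC; apply: de; rewrite subr_gt0 ab/=.
  by rewrite gtr0_norm ?subr_gt0 in bad.
near=> r.
have rs : `|Num.max r 0 - Num.max s 0| < d.
  apply: (@le_lt_trans _ _ `|r - s|); last first.
    by rewrite distrC; near: r; exists d.
  have [r0|r0] := leP r 0; have [s0|s0] := leP s 0 => //.
  - by rewrite subrr normr0.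
  - by rewrite [leLHS]distrC [leRHS]distrC !ger0_norm; lra.
  - by rewrite !ger0_norm; lra.
have m0 x : 0 <= Num.max x 0 :> R by rewrite le_max lexx orbT.
rewrite /orbit_norm; have [ab|ab] := leP (Num.max s 0) (Num.max r 0).
  exact: sub.
by rewrite distrC; apply: sub => //; [exact: ltW|rewrite distrC].
Unshelve. all: by end_near. Qed.

Variables (H : set V).
Hypothesis HB : forall f g, H f -> H g -> H (f - g).
Hypothesis HP : forall t f, 0 <= t -> H f -> H (P t f).
Notation leb := (@lebesgue_measure R).

Section delayed.
Variables (T nu : R).
Hypothesis T0 : 0 <= T.
Hypothesis nu0 : 0 < nu.
Hypothesis P_delayed : forall t f, 0 <= t -> H f ->
  `|P t f| <= expR (- nu * (t - T)) * `|f|.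

Lemma delayed_generator_ge f g : H f ->
  difference_quotient P f h @[h --> 0^'+] --> g -> `|f| <= (nu^-1 + T) * `|g|.
Proof.
move=> Hf fg; rewrite -[f in leLHS](subrK (P T f)) mulrDl [leRHS]addrC.
apply: le_trans (ler_normD _ _) (lerD (semigroup_sub_le T0 fg) _).
rewrite -[nu^-1]mul1r.
(* Measuring by [|P T f|] absorbs the delay: [|P (T + t) u| <= e^(-nu t) |u|], so the constant [C]
   is 1. *)
apply: (decay_generator_le (N := fun f => `|P T f|) PD HB HP _ nu0 ler01 P0 _ Hf fg).
  by move=> u v; rewrite linearD ler_normD.
move=> t u t0 Hu; rewrite -PD// mul1r.
by have := P_delayed (addr_ge0 T0 t0) Hu; rewrite [T + t]addrC addrK.
Qed.

End delayed.

Section averaged.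
Variables (S nu : R).
Hypothesis S0 : 0 < S.
Hypothesis nu0 : 0 < nu.
Hypothesis P_averaged : forall t f, 0 <= t -> H f ->
  (S^-1%:E * \int[leb]_(s in `[t, (t + S)%R]) (`|P s f|%R)%:E
      <= (expR (- nu * t) * `|f|)%:E)%E.

Definition orbit_average f : R :=
  S^-1 * fine (\int[leb]_(s in `[0%R, S]) (orbit_norm f s)%:E).

Let integrable_orbit f : leb.-integrable `[0%R, S] (EFin \o orbit_norm f).
Proof. by apply: continuous_itv_integrable; exact: continuous_orbit_norm. Qed.

Let orbit_averageE f : (S^-1%:E * \int[leb]_(s in `[0%R, S]) (orbit_norm f s)%:E =
  (orbit_average f)%:E)%E.
Proof.
rewrite /orbit_average EFinM fineK//; apply: integrable_fin_num => //.
exact: integrable_orbit.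
Qed.

Let Sge0 : 0 <= S^-1.
Proof. by rewrite invr_ge0 ltW. Qed.

Lemma orbit_averageD f g : orbit_average (f + g) <= orbit_average f + orbit_average g.
Proof.
rewrite -lee_fin EFinD -!orbit_averageE -ge0_muleDr ?integral_ge0//.
rewrite lee_wpmul2l ?lee_fin//.
rewrite -(integralD _ (integrable_orbit f) (integrable_orbit g))//.
apply: le_integral => //; first exact: integrable_orbit.
  by apply: integrableD => //; exact: integrable_orbit.
by move=> s _; rewrite /= -EFinD lee_fin /orbit_norm linearD ler_normD.
all: by move=> s _; rewrite lee_fin normr_ge0.
Qed.

Lemma orbit_average_decay t f : 0 <= t -> H f ->
  orbit_average (P t f) <= expR (- nu * t) * `|f|.
Proof.
move=> t0 Hf; rewrite -lee_fin; apply: le_trans (P_averaged t0 Hf).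
rewrite -orbit_averageE lee_wpmul2l ?lee_fin//.
rewrite (@eq_integral _ _ _ leb _ (fun s => (orbit_norm f s)%:E) (fun s => `|P s f|%:E)).
  rewrite integral_shift//; [|exact: ltW|exact: continuous_orbit_norm].
  rewrite le_eqVlt; apply/predU1l/eq_integral => s.
  by rewrite inE /= in_itv /= => /andP[s0 _]; rewrite orbit_norm_shift.
move=> s; rewrite inE /= in_itv /= => /andP[ts _]; rewrite orbit_normE//.
exact: le_trans ts.
Qed.

Let integral_cst_itv (x : R) : (\int[leb]_(s in `[0%R, S]) cst x%:E s = x%:E * S%:E)%E.
Proof.
rewrite integral_cst//; congr (_ * _)%E.
by have := lebesgue_measure_itv `[0, S]; rewrite /= lte_fin S0 -EFinB subr0.
Qed.

(** The orbit norm is nonincreasing, so its mean is at least its value at the end of the window. *)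
Lemma norm_le_orbit_average f t : H f -> `|P S f| <= orbit_average f.
Proof.
move=> Hf; rewrite -lee_fin -orbit_averageE.
rewrite lee_pdivlMl// muleC.
rewrite -integral_cst_itv.
apply: le_integral => //.
- by apply: (@continuous_itv_integrable _ (cst `|P S f|)); exact: cst_continuous.
- exact: integrable_orbit.
- move=> s; rewrite inE /= in_itv /= => /andP[s0 sS]; rewrite lee_fin orbit_normE//.
  exact: semigroup_norm_nonincreasing.
Qed.

Lemma averaged_delayed t f : 0 <= t -> H f ->
  `|P t f| <= expR (- nu * (t - S)) * `|f|.
Proof.
move=> t0 Hf; have [tS|St] := leP t S.
  (* Up to time [S] the exponential factor is at least 1, and contractivity suffices. *)
  apply: le_trans (Pcontr _ t0) _; rewrite ler_peMl//.
  by rewrite -expR0 ler_expR mulNr -mulrN mulr_ge0 ?(ltW nu0)// opprB subr_ge0.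
have r0 : 0 <= t - S by rewrite subr_ge0 ltW.
apply: le_trans (orbit_average_decay r0 Hf).
have -> : P t f = P S (P (t - S) f) by rewrite -PD ?(ltW S0)// addrC subrK.
by apply: norm_le_orbit_average => //; exact: HP.
Qed.

(** Averaging [|f| <= |P s f| + s |g|] over [[0, S]] yields [S / 2], the mean of [s]; the averaged
    orbit norm is bounded by telescoping with constant 1. *)
Lemma averaged_generator_ge f g : H f ->
  difference_quotient P f h @[h --> 0^'+] --> g -> `|f| <= (nu^-1 + S / 2) * `|g|.
Proof.
move=> Hf fg.
have Nf : orbit_average f <= 1 / nu * `|g|.
  apply: (decay_generator_le PD HB HP orbit_averageD nu0 ler01 P0 _ Hf fg).
  by move=> t u t0 Hu; rewrite mul1r; exact: orbit_average_decay.
suff : `|f| <= orbit_average f + S / 2 * `|g|.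
  by move=> /le_trans; apply; rewrite mulrDl lerD2r -[nu^-1]mul1r.
have ids : leb.-integrable `[0%R, S] (EFin \o (fun s => `|g| * s)).
  by apply: continuous_itv_integrable => s; apply: cvgM; [exact: cvg_cst|exact: cvg_id].
have : (\int[leb]_(s in `[0%R, S]) cst (`|f|%R)%:E s <=
    \int[leb]_(s in `[0%R, S]) ((orbit_norm f s)%:E + (`|g| * s)%:E))%E.
  apply: le_integral => //.
  - by apply: (@continuous_itv_integrable _ (cst `|f|)); exact: cst_continuous.
  - by apply: integrableD => //; exact: integrable_orbit.
  - move=> s; rewrite inE /= in_itv /= => /andP[s0 sS].
    rewrite -EFinD lee_fin orbit_normE// -[f in leLHS](subrK (P s f)) addrC.
    apply: le_trans (ler_normD _ _) _; rewrite lerD2l mulrC.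
    exact: semigroup_sub_le.
rewrite (integralD _ (integrable_orbit f) ids)// integral_cst_itv.
have -> : (\int[leb]_(s in `[0%R, S]) (`|g| * s)%:E = (`|g| * (S ^+ 2 / 2))%:E)%E.
  rewrite EFinM -lebesgue_integral_id// -integralZl//.
  by apply: continuous_itv_integrable => s; exact: cvg_id.
rewrite -(@fineK _ (\int[leb]_(s in _) (orbit_norm f s)%:E)%E); last first.
  by apply: integrable_fin_num => //; exact: integrable_orbit.
rewrite -EFinM -EFinD lee_fin -ler_pdivlMr// => /le_trans; apply.
rewrite /orbit_average mulrDl [_ * S^-1]mulrC lerD2l le_eqVlt; apply/predU1l.
by field; rewrite gt_eqF.
Qed.

End averaged.
End contraction_semigroup.

(** * Markov semigroups *)

Section markov.
Context d (X : measurableType d) (R : realType) (mu : probability X R).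
Variable P : R -> {linear L2 mu -> L2 mu}.
Hypothesis hP : markov_semigroup P.
Implicit Types (f g : L2 mu) (t nu T : R).

Let cP : c0_contraction_semigroup P := markov_c0 hP.

Let P0 f : P 0 f = f.
Proof. exact: semigroup0 cP f. Qed.

Let PD s t f : 0 <= s -> 0 <= t -> P (s + t) f = P s (P t f).
Proof. exact: semigroupD cP s t f. Qed.

Lemma L20_ZD (a : R) f g : L20 f -> L20 g -> L20 (a *: f + g).
Proof. by move=> /L20P f0 /L20P g0; apply/L20P; rewrite L2_meanZD f0 g0 mulr0 addr0. Qed.

Lemma L20_0 : L20 (0 : L2 mu).
Proof.
apply/L20P; have := L2_meanZD 1 (0 : L2 mu) 0.
by rewrite scaler0 addr0 mul1r; lra.
Qed.

Lemma L20_B f g : L20 f -> L20 g -> L20 (f - g).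
Proof. by move=> f0 g0; rewrite addrC -scaleN1r; exact: L20_ZD. Qed.

Lemma L20_semigroup t f : 0 <= t -> L20 f -> L20 (P t f).
Proof. by move=> t0 f0; rewrite /L20 /= (markov_invariant hP). Qed.

(** Difference quotients of mean-zero vectors have mean zero, and the mean is continuous. *)
Lemma L20_generator f g : L20 f ->
  difference_quotient P f h @[h --> 0^'+] --> g -> L20 g.
Proof.
move=> f0 /cvg_at_right0P fg; apply/L20P/eqP; rewrite -normr_le0.
apply/ler_addgt0Pr => e e0; have [dl dl0 dle] := fg e e0.
have h0 : 0 < dl / 2 < dl by rewrite divr_gt0//= ltr_pdivrMr// ltr_pMr// ltr1n.
have dh : L20 (difference_quotient P f (dl / 2)).
  rewrite /difference_quotient -[_ *: _]addr0; apply: L20_ZD L20_0.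
  by apply: L20_B => //; apply: L20_semigroup => //; case/andP: h0 => /ltW.
rewrite add0r; apply: le_trans (dle _ h0); apply: le_trans (L2_mean_le _).
rewrite addrC -scaleN1r L2_meanZD mulN1r.
by have /L20P -> := dh; rewrite addr0 normrN.
Qed.

Lemma spectral_gap_ge S nu : delayed_exp_contractive P S nu ->
  (nu%:E <= spectral_gap P)%E.
Proof.
move=> dP; apply: le_ereal_inf_tmp => _ [a sa <-]; rewrite lee_fin leNgt.
apply/negP => anu; apply: sa; apply: (delayed_resolvent (S := S) (nu := nu)) => //.
- exact: (semigroup_continuous cP).
- exact: L20_0.
- exact: L20_ZD.
- exact: L20_semigroup.
- exact: L20_seq_complete.
- exact: L20_generator.
- by move=> t f t0 f0; exact: dP.
Qed.

(** The bound passes to the infimum as [c^-1 <= s(L)] and is inverted afterwards in the extended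
    reals, so an infinite gap is covered too. *)
Lemma singular_value_gap_inv_le (c : R) : 0 < c ->
  (forall f g, L20 f -> difference_quotient P f h @[h --> 0^'+] --> g ->
    `|f| <= c * `|g|) ->
  ((singular_value_gap P)^-1 <= c%:E)%E.
Proof.
move=> c0 cfg; have cV : (c^-1%:E <= singular_value_gap P)%E.
  apply: le_ereal_inf_tmp => _ [f [[f0 df] fn0] <-]; rewrite lee_fin.
  rewrite ler_pdivlMr ?normr_gt0// mulrC ler_pdivrMr// mulrC.
  exact: cfg f0 df.
have cE : c%:E = (c^-1%:E)^-1%E by rewrite inver invr_eq0 gt_eqF// invrK.
have c0' : (0 <= c^-1%:E)%E by rewrite lee_fin invr_ge0 ltW.
by rewrite cE lee_pV2// inE; exact: le_trans cV.
Qed.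

Lemma average_delayed T nu : 0 < T -> 0 < nu ->
  average_exp_contractive P T nu -> delayed_exp_contractive P T nu.
Proof.
move=> T0 nu0 aP f t f0 t0.
apply: (averaged_delayed cP L20_semigroup T0 nu0 _ t0 f0).
by move=> r g r0 g0; exact: aP.
Qed.

(** Iterating [n] times, with [n] the integer part of [s / t], gives a factor [e^(-n)], and
    [n >= s / t - 1 = (s - t) / t]. *)
Lemma relaxation_delayed t : 0 < t ->
  (forall f, L20 f -> `|P t f| <= expR (-1) * `|f|) ->
  delayed_exp_contractive P t t^-1.
Proof.
move=> t0 tP f s f0 s0.
pose n := Num.truncn (s / t).
have /truncn_itv/andP[ns sn] : 0 <= s / t by rewrite divr_ge0// ltW.
have nP m : `|P (t * m%:R) f| <= expR (- m%:R) * `|f|.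
  elim: m => [|m IHm]; first by rewrite mulr0 oppr0 expR0 mul1r P0.
  have tm : 0 <= t * m%:R by rewrite mulr_ge0// ltW.
  rewrite -natr1 mulrDr mulr1 addrC PD ?(ltW t0)//.
  apply: le_trans (tP _ (L20_semigroup tm f0)) _.
  by rewrite opprD expRD [expR _ * expR _]mulrC -mulrA ler_wpM2l ?expR_ge0.
have ts : t * n%:R <= s by rewrite mulrC -ler_pdivlMr.
apply: le_trans (semigroup_norm_nonincreasing cP f _ ts) _.
  by rewrite mulr_ge0// ltW.
apply: le_trans (nP n) _; rewrite ler_wpM2r// ler_expR mulNr lerN2.
rewrite mulrC mulrBl divff ?gt_eqF// lerBlDr natr1; exact: ltW.
Qed.

Lemma delayed_singular_value_gap T nu : 0 < T -> 0 < nu ->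
  delayed_exp_contractive P T nu ->
  ((singular_value_gap P)^-1 <= (nu^-1 + T)%:E)%E.
Proof.
move=> T0 nu0 dP; apply: singular_value_gap_inv_le => [|f g].
  by rewrite addr_gt0// invr_gt0.
apply: (delayed_generator_ge cP L20_B L20_semigroup (ltW T0) nu0).
by move=> t u t0 u0; exact: dP.
Qed.

End markov.

Theorem lemma10 (d : measure_display) (X : measurableType d) (R : realType)
    (mu : probability X R) (P : R -> {linear L2 mu -> L2 mu})
    (hP : markov_semigroup P) :
  (forall T nu : R, 0 < T -> 0 < nu ->
    delayed_exp_contractive P T nu \/ average_exp_contractive P (2 * T) nu ->
    ((spectral_gap P)^-1 <= (nu^-1)%:E)%E /\
    ((singular_value_gap P)^-1 <= (nu^-1 + T)%:E)%E) /\
  ((2^-1)%:E * (singular_value_gap P)^-1 <= relaxation_time P)%E.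
Proof.
split=> [T nu T0 nu0 TnuP|].
  split.
    (* The length of the delay does not enter the spectral bound, so both hypotheses reduce to some
       delayed contractivity. *)
    have [S SP] : exists S, delayed_exp_contractive P S nu.
      case: TnuP => [dP|aP]; first by exists T.
      by exists (2 * T); apply: average_delayed => //; rewrite mulr_gt0.
    have nuE : (nu^-1)%:E = (nu%:E)^-1%E by rewrite inver gt_eqF.
    have gap := spectral_gap_ge hP SP.
    have nu0' : (0 <= nu%:E)%E by rewrite lee_fin ltW.
    by rewrite nuE lee_pV2// inE; exact: le_trans gap.
  case: TnuP => [|aP]; first exact: delayed_singular_value_gap.
  have T20 : 0 < 2 * T by rewrite mulr_gt0.
  apply: (singular_value_gap_inv_le) => [|f g f0 fg].
    by rewrite addr_gt0// invr_gt0.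
  (* Applying the averaged bound directly, with window [2 T], gives [T]; passing through delayed
     contractivity would only give [2 T]. *)
  have -> : T = 2 * T / 2 by rewrite mulrC mulKf.
  apply: (averaged_generator_ge (markov_c0 hP) (@L20_B _ _ _ mu) (L20_semigroup hP)
    T20 nu0 _ f0 fg) => t u t0 u0.
  exact: aP.
apply: le_ereal_inf_tmp => _ [t [t0 tP] <-].
(* At [t = 0] the inequality [|f| <= e^(-1) |f|] leaves no nonzero vector of mean zero: the singular
   value gap is the infimum of the empty set and its inverse is 0. *)
have /predU1P[{}t0|{}t0] : (0 == t) || (0 < t) by rewrite -le_eqVlt.
  rewrite -t0 /singular_value_gap.
  rewrite (_ : [set _ | _ in _] = set0) ?ereal_inf0 ?invey ?mule0//.
  rewrite -subset0 => _ [f [[f0 _] /= fn0] _].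
  have := tP f f0; rewrite -t0 (semigroup0 (markov_c0 hP)).
  rewrite leNgt => /negP; apply.
  by rewrite gtr_pMl ?normr_gt0// expR_lt1 ltrN10.
have ti0 : 0 < t^-1 by rewrite invr_gt0.
(* Delay [t] and rate [1/t] bound the inverse gap by [t + t], whence the factor one half. *)
have := delayed_singular_value_gap hP t0 ti0 (relaxation_delayed hP t0 tP).
rewrite invrK => st; apply: (@le_trans _ _ (2^-1%:E * (t + t)%:E)%E).
  by rewrite lee_wpmul2l// lee_fin invr_ge0.
by rewrite -EFinM lee_fin; lra.
Qed.
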